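(* Let $R$ be a commutative ring with unit and $\bar p$ a perversity on a poset $P$. The families $(\mathtt K(R,n,P,\bar p))_{n\ge0}$ and $(\mathtt K(R,n,P,\bar p)^+)_{n\ge0}$, pointed by the zero cocycles $\epsilon$, are infinite loop spaces in the simplicial categories $\mathrm{Sset}_P$ and $\mathrm{Sset}_P^+$ respectively; i.e. for every $n\ge1$ there are weak $s$-equivalences $$\mathtt K(R,n-1,P,\bar p)\simeq\Omega_\epsilon\mathtt K(R,n,P,\bar p)\quad\text{and}\quad \mathtt K(R,n-1,P,\bar p)^+\simeq\Omega_\epsilon\mathtt K(R,n,P,\bar p)^+ .$$
   Context: **Simplicial sets over $P$.** $N(P)$ is the nerve of $P$. An object of $\mathrm{Sset}_P$ is a simplicial map $\Psi_L\colon L\to N(P)$; morphisms are simplicial maps over $N(P)$. Equivalently it is a presheaf on the category $\Delta[P]$ of simplices of $N(P)$ (objects: simplicial maps $\sigma\colon\Delta[k]\to N(P)$; morphisms: simplicial maps over $N(P)$). A simplex $s_0\preceq\dots\preceq s_k$ of $N(P)$ is regular if $s_k$ is maximal in $P$; $\Delta[P]^+\subset\Delta[P]$ is the full subcategory of regular simplices and $\mathrm{Sset}_P^+$ is the category of presheaves on $\Delta[P]^+$. **Simplicial structure.** For $\mathcal C=\mathrm{Sset}_P$ or $\mathrm{Sset}^+_P$, $A\in\mathcal C$ and a simplicial set $K$, $(A\otimes K)(\sigma)=A(\sigma)\times K_k$ for $\sigma$ of dimension $k$; $\mathrm{Hom}^\Delta_{\mathcal C}(A,B)$ has $k$-simplices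 $\mathrm{Hom}_{\mathcal C}(A\otimes\Delta[k],B)$; $[A,B]=\pi_0\mathrm{Hom}^\Delta_{\mathcal C}(A,B)$; $B^K$ is characterized by $\mathrm{Hom}_{\mathcal C}(A,B^K)\cong\mathrm{Hom}_{\mathcal C}(A\otimes K,B)$. An object $A$ is $s$-fibrant if $\mathrm{Hom}^\Delta_{\mathcal C}(Z,A)$ is a Kan complex for all $Z$. A map $A\to B$ is a weak $s$-equivalence if $[Z,A]\to[Z,B]$ is bijective for all $Z$. A pointed object is $(X,\epsilon)$ with $\epsilon\colon *\to X$, $*$ the final object; $\Omega_\epsilon X$ is the pullback of $X^{\Delta[1]}\to X^{\partial\Delta[1]}\cong X\times X$ along $(\epsilon,\epsilon)\colon*\to X\times X$. An infinite loop space in $\mathcal C$ is a sequence of $s$-fibrant pointed objects $(B_i,\epsilon_i)_{i\in\mathbb N}$ with $B_i$ weakly $s$-equivalent to $\Omega_{\epsilon_{i+1}}B_{i+1}$. **Perversities.** A perversity on $P$ is a map $\bar p\colon P\to\mathbb Z\cup\{\pm\infty\}$ equal to $0$ on maximal elements. **Blown-up cochains.** $N^*(-)$ denotes normalized simplicial cochains with coefficients in $R$. A simplex $\sigma$ of $N(P)$ is written $s_0^{[q_0]}\prec\dots\prec s_\ell^{[q_\ell]}$ ($s_i$ repeated $q_i+1$ times, $q_i\ge 0$), giving $\Delta[m]=\Delta[q_0]*\dots*\Delta[q_\ell]$. Let $c\Delta[q]$ be the cone on $\Delta[q]$ with apex $v$ as last vertex, $c\emptyset=\{v\}$. For regular $\sigma$,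 $\widetilde N^*(\sigma)=N^*(c\Delta[q_0])\otimes\dots\otimes N^*(c\Delta[q_{\ell-1}])\otimes N^*(\Delta[q_\ell])$. It has the basis $\mathbf 1_{(F,\varepsilon)}=\mathbf 1_{(F_0,\varepsilon_0)}\otimes\dots\otimes\mathbf 1_{(F_{\ell-1},\varepsilon_{\ell-1})}\otimes\mathbf 1_{F_\ell}$, where for $i<\ell$, $(F_i,0)$ is a non-empty face $F_i$ of $\Delta[q_i]$, $(F_i,1)$ is the cone $cF_i$ with $F_i$ a possibly empty face, and $F_\ell$ is a face of $\Delta[q_\ell]$. For $s\in P$ the perverse degree $\|\mathbf 1_{(F,\varepsilon)}\|_s$ is $\dim\big((F_{i+1},\varepsilon_{i+1})\times\dots\times F_\ell\big)$ if $s=s_i$ with $i<\ell$ and $\varepsilon_i=0$; it is $0$ if $s=s_\ell$; it is $-\infty$ otherwise. For a linear combination with non-zero coefficients take the maximum; $\|0\|_s=-\infty$. A cochain $\omega$ is $\bar p$-allowable if $\|\omega\|_s\le\bar p(s)$ for all $s$; $\widetilde N^*_{\bar p}(\sigma)$ is the complex of $\omega$ such that $\omega$ and $\delta\omega$ are $\bar p$-allowable. Put $\widetilde N_{\bar p}^*(\sigma)=0$ for non-regular $\sigma$. For a morphism $\alpha\colon\sigma\to\tau$ of regular simplices over $N(P)$, $\alpha^*\colon\widetilde N^*(\tau)\to\widetilde N^*(\sigma)$ is the tensor product of the restrictions along the (coned) maps between the blocks over the same element of $P$, and, for a block of $\tau$ over an element not occurring in $\sigma$, of the restriction $N^*(c\Delta[q])\to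 N^*(\{v\})=R$; this preserves $\widetilde N^*_{\bar p}$, so $\sigma\mapsto\widetilde N^k_{\bar p}(\sigma)$ is a presheaf on $\Delta[P]$. **Perverse Eilenberg–MacLane spaces.** $\mathtt K(R,n,P,\bar p)\in\mathrm{Sset}_P$ is the presheaf $\sigma\mapsto\mathcal Z^n\widetilde N^*_{\bar p}(\sigma)$ (degree $n$ cocycles) on $\Delta[P]$, and $\mathtt K(R,n,P,\bar p)^+\in\mathrm{Sset}_P^+$ is its restriction to $\Delta[P]^+$. The base point $\epsilon$ is given by the zero cocycle on every simplex. *)

(* Defs.v *)
From HB Require Import structures.
From mathcomp Require Import all_boot all_order all_algebra.
From mathcomp Require Import boolp constructive_ereal.
From Stdlib Require Import Relation_Operators.

Set Implicit Arguments.
Unset Strict Implicit.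
Unset Printing Implicit Defensive.

Import Order.TTheory GRing.Theory.
Local Open Scope ring_scope.

#[local] Obligation Tactic := idtac.

Record category := Category {
  ob :> Type;
  hom : ob -> ob -> Type;
  idm : forall a, hom a a;
  comp : forall a b c, hom b c -> hom a b -> hom a c;
  comp_idl : forall a b (f : hom a b), comp (idm b) f = f;
  comp_idr : forall a b (f : hom a b), comp f (idm a) = f;
  comp_assoc : forall a b c e (h : hom c e) (g : hom b c) (f : hom a b),
    comp h (comp g f) = comp (comp h g) f }.

Arguments idm {_} a.
Arguments comp {_} [a b c].

Record functor (C D : category) := Functor {
  fob :> C -> D;
  fmap : forall a b, hom a b -> hom (fob a) (fob b);
  fmap_id : forall a, fmap (idm a) = idm (fob a);
  fmap_comp : forall a b c (g : hom b c) (f : hom a b),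
    fmap (comp g f) = comp (fmap g) (fmap f) }.

Program Definition functor_comp (C D E : category) (G : functor D E)
    (F : functor C D) : functor C E :=
  @Functor C E (fun a => G (F a)) (fun a b f => fmap G (fmap F f)) _ _.
Next Obligation. by move=> * /=; rewrite !fmap_id. Qed.
Next Obligation. by move=> * /=; rewrite !fmap_comp. Qed.

Program Definition full (C : category) (Q : C -> Prop) : category :=
  @Category {a : C | Q a} (fun a b => hom (sval a) (sval b))
    (fun a => idm (sval a)) (fun a b c g f => comp g f) _ _ _.
Next Obligation. by move=> * /=; apply: comp_idl. Qed.
Next Obligation. by move=> * /=; apply: comp_idr. Qed.
Next Obligation. by move=> * /=; apply: comp_assoc. Qed.

Program Definition full_incl (C : category) (Q : C -> Prop) :
    functor (full Q) C :=
  @Functor (full Q) C (fun a => sval a) (fun a b f => f) _ _.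
Next Obligation. by []. Qed.
Next Obligation. by []. Qed.

Record presheaf (C : category) := Presheaf {
  psob :> C -> Type;
  act : forall a b, hom a b -> psob b -> psob a;
  act_id : forall a x, act (idm a) x = x;
  act_comp : forall a b c (g : hom b c) (f : hom a b) x,
    act (comp g f) x = act f (act g x) }.

Record psmap (C : category) (A B : presheaf C) := PsMap {
  psapp :> forall a, A a -> B a;
  psnat : forall a b (f : hom a b) x, psapp (act f x) = act f (psapp x) }.

Lemma psmap_eq (C : category) (A B : presheaf C) (f g : psmap A B) :
  (forall a x, f a x = g a x) -> f = g.
Proof.
case: f g => [f f_nat] [g g_nat] /= fg.
have {}fg : f = g by apply: functional_extensionality_dep => a; apply: funext.
by case: _ / fg g_nat => g_nat; congr PsMap; apply: Prop_irrelevance.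
Qed.

Program Definition psid (C : category) (A : presheaf C) : psmap A A :=
  PsMap (psapp := fun a x => x) _.
Next Obligation. by []. Qed.

Program Definition pscomp (C : category) (A B E : presheaf C)
    (g : psmap B E) (f : psmap A B) : psmap A E :=
  PsMap (psapp := fun a x => g a (f a x)) _.
Next Obligation. by move=> * /=; rewrite !psnat. Qed.

Program Definition restrict (C D : category) (F : functor C D)
    (A : presheaf D) : presheaf C :=
  @Presheaf C (fun a => A (F a)) (fun a b f => act (fmap F f)) _ _.
Next Obligation. by move=> * /=; rewrite fmap_id act_id. Qed.
Next Obligation. by move=> * /=; rewrite fmap_comp act_comp. Qed.

Program Definition yoneda (C : category) (a : C) : presheaf C :=
  @Presheaf C (fun b => hom b a) (fun b c f x => comp x f) _ _.
Next Obligation. by move=> * /=; apply: comp_idr. Qed.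
Next Obligation. by move=> * /=; apply: comp_assoc. Qed.

Program Definition yoneda_map (C : category) (a b : C) (f : hom a b) :
    psmap (yoneda a) (yoneda b) :=
  @PsMap C (yoneda a) (yoneda b) (fun c x => comp f x) _.
Next Obligation. by move=> * /=; apply: comp_assoc. Qed.

Program Definition subpresheaf (C : category) (A : presheaf C)
    (S : forall a, A a -> Prop)
    (Sact : forall a b (f : hom a b) x, S b x -> S a (act f x)) : presheaf C :=
  @Presheaf C (fun a => {x : A a | S a x})
    (fun a b f x => exist _ (act f (sval x)) (Sact _ _ f _ (svalP x))) _ _.
Next Obligation. by move=> C A S Sact a [x Sx]; apply: eq_exist; apply: act_id. Qed.
Next Obligation. by move=> * /=; apply: eq_exist; apply: act_comp. Qed.

Program Definition subpresheaf_incl (C : category) (A : presheaf C)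
    (S : forall a, A a -> Prop)
    (Sact : forall a b (f : hom a b) x, S b x -> S a (act f x)) :
    psmap (subpresheaf Sact) A :=
  @PsMap C (subpresheaf Sact) A (fun a x => sval x) _.
Next Obligation. by []. Qed.

Program Definition final (C : category) : presheaf C :=
  @Presheaf C (fun _ => unit) (fun _ _ _ x => x) _ _.
Next Obligation. by []. Qed.
Next Obligation. by []. Qed.

Program Definition psprod (C : category) (A B : presheaf C) : presheaf C :=
  @Presheaf C (fun a => (A a * B a)%type)
    (fun a b f x => (act f x.1, act f x.2)) _ _.
Next Obligation. by move=> C A B a [x y] /=; rewrite !act_id. Qed.
Next Obligation. by move=> * /=; rewrite !act_comp. Qed.

Program Definition pspair (C : category) (Z A B : presheaf C)
    (f : psmap Z A) (g : psmap Z B) : psmap Z (psprod A B) :=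
  @PsMap C Z (psprod A B) (fun a z => (f a z, g a z)) _.
Next Obligation. by move=> * /=; rewrite !psnat. Qed.

Lemma pullback_act (C : category) (A B E : presheaf C) (f : psmap A E)
    (g : psmap B E) a b (u : hom a b) (x : psprod A B b) :
  f b x.1 = g b x.2 -> f a (act u x).1 = g a (act u x).2.
Proof. by move=> fg; rewrite !psnat fg. Qed.

Definition pullback (C : category) (A B E : presheaf C) (f : psmap A E)
    (g : psmap B E) : presheaf C :=
  @subpresheaf C (psprod A B) (fun a x => f a x.1 = g a x.2)
    (@pullback_act C A B E f g).

Definition monotoneb (d : Order.disp_t) (T : porderType d) (k : nat)
    (f : {ffun 'I_k.+1 -> T}) : bool :=
  [forall i : 'I_k.+1, forall j : 'I_k.+1, (i <= j)%N ==> (f i <= f j)%O].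

(* The k-simplices of the nerve N(T); for T = 'I_l.+1 these are the morphisms
   [k] -> [l] of the simplex category. *)
Record nerve (d : Order.disp_t) (T : porderType d) (k : nat) := Chain {
  chain_fun :> {ffun 'I_k.+1 -> T};
  chain_mono : monotoneb chain_fun }.

HB.instance Definition _ d T k := [isSub for @chain_fun d T k].
HB.instance Definition _ d T k := [Equality of @nerve d T k by <:].

Lemma nerveP (d : Order.disp_t) (T : porderType d) k (x y : nerve T k) :
  (forall i, x i = y i) -> x = y.
Proof. by move=> xy; apply: val_inj; apply/ffunP. Qed.

Lemma chain_le (d : Order.disp_t) (T : porderType d) k (x : nerve T k)
    (i j : 'I_k.+1) :
  (i <= j)%N -> (x i <= x j)%O.
Proof. by case: x => x /= /forallP/(_ i)/forallP/(_ j)/implyP. Qed.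

Lemma ncomp_mono (d : Order.disp_t) (T : porderType d) k l (x : nerve T l)
    (a : nerve 'I_l.+1 k) : monotoneb [ffun i => x (a i)].
Proof.
apply/forallP => i; apply/forallP => j; apply/implyP => ij.
by rewrite !ffunE; apply: chain_le; apply: (chain_le a).
Qed.

Definition ncomp (d : Order.disp_t) (T : porderType d) k l (x : nerve T l)
  (a : nerve 'I_l.+1 k) : nerve T k := Chain (ncomp_mono x a).

Lemma ncst_mono (d : Order.disp_t) (T : porderType d) k (t : T) :
  monotoneb [ffun _ : 'I_k.+1 => t].
Proof. by apply/forallP => i; apply/forallP => j; rewrite !ffunE lexx implybT. Qed.

Definition ncst (d : Order.disp_t) (T : porderType d) k (t : T) : nerve T k :=
  Chain (ncst_mono k t).

Lemma nid_mono k : monotoneb [ffun i : 'I_k.+1 => i].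
Proof. by apply/forallP => i; apply/forallP => j; rewrite !ffunE leEord implybb. Qed.

Definition nid k : nerve 'I_k.+1 k := Chain (nid_mono k).

Program Definition Delta : category :=
  @Category nat (fun k l => nerve 'I_l.+1 k) nid
    (fun k l m g f => ncomp g f) _ _ _.
Next Obligation. by move=> k l f; apply: nerveP => i; rewrite !ffunE. Qed.
Next Obligation. by move=> k l f; apply: nerveP => i; rewrite !ffunE. Qed.
Next Obligation. by move=> * /=; apply: nerveP => i; rewrite !ffunE. Qed.

Definition sset := presheaf Delta.

Definition stdsimplex (n : nat) : sset := @yoneda Delta n.

Lemma boundary_act n (k l : Delta) (f : hom k l) (x : stdsimplex n l) :
  (exists j, forall i, x i != j) -> exists j, forall i, act f x i != j.
Proof. by case=> j xj; exists j => i; rewrite ffunE. Qed.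

Definition boundary (n : nat) : sset := subpresheaf (@boundary_act n).

Lemma horn_act n (r : 'I_n.+1) (k l : Delta) (f : hom k l) (x : stdsimplex n l) :
  (exists2 j, j != r & forall i, x i != j) ->
  exists2 j, j != r & forall i, act f x i != j.
Proof. by case=> j jr xj; exists j => // i; rewrite ffunE. Qed.

Definition horn (n : nat) (r : 'I_n.+1) : sset := subpresheaf (@horn_act n r).

Definition kan (X : sset) : Prop :=
  forall n (r : 'I_n.+2) (f : psmap (horn r) X),
  exists g : psmap (stdsimplex n.+1) X,
    pscomp g (subpresheaf_incl (@horn_act n.+1 r)) = f.

Definition connected (X : sset) : X 0%N -> X 0%N -> Prop :=
  clos_refl_sym_trans (X 0%N) (fun x y => exists e : X 1%N,
    act (ncst 0 (ord0 : 'I_2) : @hom Delta 0%N 1%N) e = x /\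
    act (ncst 0 (ord_max : 'I_2) : @hom Delta 0%N 1%N) e = y).

Arguments connected {X}.

Definition pi0 (X : sset) : Type :=
  {c : X 0%N -> Prop | exists x, c = connected x}.

Lemma connected_map (X Y : sset) (f : psmap X Y) x y :
  connected x y -> connected (f 0%N x) (f 0%N y).
Proof.
elim=> [{}x {}y [e [<- <-]]|{}x|{}x {}y _|{}x {}y z _ xy _ yz].
- by apply: rst_step; exists (f 1%N e); rewrite -!psnat.
- exact: rst_refl.
- exact: rst_sym.
- exact: rst_trans yz.
Qed.

Lemma pi0_map_subproof (X Y : sset) (f : psmap X Y) (c : pi0 X) :
  exists y, (fun y' => exists2 x, sval c x & connected (f 0%N x) y') = connected y.
Proof.
case: c => c /= [x ->]; exists (f 0%N x); apply: funext => y; apply: propext.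
split=> [[x' xx' x'y]|xy]; last by exists x => //; apply: rst_refl.
exact: rst_trans (connected_map f xx') x'y.
Qed.

Definition pi0_map (X Y : sset) (f : psmap X Y) (c : pi0 X) : pi0 Y :=
  exist _ _ (pi0_map_subproof f c).

(* In what follows the functor [D] gives the dimension of the objects of [C]. *)

Definition tensor (C : category) (D : functor C Delta)
    (A : presheaf C) (K : sset) : presheaf C :=
  psprod A (restrict D K).

Program Definition tensor_map (C : category) (D : functor C Delta)
    (A B : presheaf C) (K L : sset) (f : psmap A B) (g : psmap K L) :
    psmap (tensor D A K) (tensor D B L) :=
  @PsMap C (tensor D A K) (tensor D B L) (fun a x => (f a x.1, g (D a) x.2)) _.
Next Obligation. by move=> * /=; rewrite !psnat. Qed.

Program Definition HomDelta (C : category) (D : functor C Delta)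
    (A B : presheaf C) : sset :=
  @Presheaf Delta (fun k => psmap (tensor D A (stdsimplex k)) B)
    (fun k l f h => pscomp h (tensor_map D (psid A) (yoneda_map f))) _ _.
Next Obligation.
move=> C D A B k h; apply: psmap_eq => a [x y] /=.
by congr (h a (_, _)); apply: (@comp_idl Delta).
Qed.
Next Obligation.
move=> C D A B k l m g f h; apply: psmap_eq => a [x y] /=.
by congr (h a (_, _)); apply/esym/(@comp_assoc Delta).
Qed.

Program Definition HomDelta_map (C : category) (D : functor C Delta)
    (Z A B : presheaf C) (f : psmap A B) :
    psmap (HomDelta D Z A) (HomDelta D Z B) :=
  @PsMap Delta (HomDelta D Z A) (HomDelta D Z B) (fun k h => pscomp f h) _.
Next Obligation. by move=> * /=; apply: psmap_eq. Qed.

Definition s_fibrant (C : category) (D : functor C Delta) (A : presheaf C) :=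
  forall Z : presheaf C, kan (HomDelta D Z A).

Definition weak_s_equivalence (C : category) (D : functor C Delta)
    (A B : presheaf C) (f : psmap A B) : Prop :=
  forall Z : presheaf C, bijective (pi0_map (HomDelta_map D Z f)).

(* The Yoneda lemma forces this formula for B^K; see [expo_curryK] and
   [expo_uncurryK] for the universal property. *)
Program Definition expo (C : category) (D : functor C Delta)
    (B : presheaf C) (K : sset) : presheaf C :=
  @Presheaf C (fun a => psmap (tensor D (yoneda a) K) B)
    (fun a b f h => pscomp h (tensor_map D (yoneda_map f) (psid K))) _ _.
Next Obligation.
by move=> C D B K a h; apply: psmap_eq => b [x y] /=; rewrite comp_idl.
Qed.
Next Obligation.
by move=> C D B K a b c g f h; apply: psmap_eq => e [x y] /=; rewrite comp_assoc.
Qed.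

Program Definition expo_curry (C : category) (D : functor C Delta)
    (A B : presheaf C) (K : sset) (h : psmap (tensor D A K) B) :
    psmap A (expo D B K) :=
  @PsMap C A (expo D B K) (fun a x =>
    @PsMap C (tensor D (yoneda a) K) B (fun b y => h b (act y.1 x, y.2)) _) _.
Next Obligation. by move=> * /=; rewrite -psnat /= act_comp. Qed.
Next Obligation. by move=> * /=; apply: psmap_eq => ? [? ?] /=; rewrite act_comp. Qed.

Program Definition expo_uncurry (C : category) (D : functor C Delta)
    (A B : presheaf C) (K : sset) (h : psmap A (expo D B K)) :
    psmap (tensor D A K) B :=
  @PsMap C (tensor D A K) B (fun a x => h a x.1 a (idm a, x.2)) _.
Next Obligation.
move=> C D A B K h a b f [x y] /=; rewrite psnat /= -psnat /=.
by rewrite comp_idl comp_idr.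
Qed.

Lemma expo_curryK (C : category) (D : functor C Delta) (A B : presheaf C) K :
  cancel (@expo_curry C D A B K) (@expo_uncurry C D A B K).
Proof. by move=> h; apply: psmap_eq => a [x y] /=; rewrite act_id. Qed.

Lemma expo_uncurryK (C : category) (D : functor C Delta) (A B : presheaf C) K :
  cancel (@expo_uncurry C D A B K) (@expo_curry C D A B K).
Proof.
move=> h; apply: psmap_eq => a x; apply: psmap_eq => b [u y] /=.
by rewrite psnat /= comp_idr.
Qed.

Program Definition expo_map (C : category) (D : functor C Delta)
    (B : presheaf C) (K L : sset) (g : psmap K L) :
    psmap (expo D B L) (expo D B K) :=
  @PsMap C (expo D B L) (expo D B K)
    (fun a h => pscomp h (tensor_map D (psid (yoneda a)) g)) _.
Next Obligation. by move=> * /=; apply: psmap_eq. Qed.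

Lemma boundary1_vertex (e : 'I_2) k :
  exists j, forall i, (ncst k e : stdsimplex 1 k) i != j.
Proof. by exists (rev_ord e) => i; rewrite ffunE; case: e => [[|[]]]. Qed.

Definition bdvertex (e : 'I_2) (k : Delta) : boundary 1 k :=
  exist _ (ncst k e : stdsimplex 1 k) (boundary1_vertex e k).

Lemma bdvertex_act (e : 'I_2) (k l : Delta) (f : hom k l) :
  act f (bdvertex e l) = bdvertex e k.
Proof. by apply: eq_exist; apply: nerveP => i; rewrite !ffunE. Qed.

Program Definition expo_ev (C : category) (D : functor C Delta)
    (X : presheaf C) (e : 'I_2) : psmap (expo D X (boundary 1)) X :=
  @PsMap C (expo D X (boundary 1)) X
    (fun a h => h a (idm a, bdvertex e (D a))) _.
Next Obligation.
move=> C D X e a b f h; rewrite -psnat /= comp_idl comp_idr.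
by congr (h a (_, _)); rewrite -(bdvertex_act e (fmap D f)).
Qed.

(* The isomorphism between X^(boundary of Delta[1]) and X * X. *)
Definition expo_boundary (C : category) (D : functor C Delta)
    (X : presheaf C) : psmap (expo D X (boundary 1)) (psprod X X) :=
  pspair (expo_ev D X ord0) (expo_ev D X ord_max).

Lemma expo_boundary_bij (C : category) (D : functor C Delta) (X : presheaf C) a :
  bijective (expo_boundary D X a).
Proof.
have bdE b (x : boundary 1 b) : x = bdvertex (sval x ord0) b.
  case: x => x [j xj]; apply: eq_exist; apply: nerveP => i; rewrite ffunE /=.
  have I2 : forall u v w : 'I_2, u != w -> v != w -> u = v.
    by move=> [[|[|//]] ?] [[|[|//]] ?] [[|[|//]] ?] // _ _; apply: val_inj.
  exact: I2 _ _ _ (xj i) (xj ord0).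
pose T := tensor D (yoneda a) (boundary 1).
pose inv0 x b (y : T b) : X b :=
  act y.1 (if sval y.2 ord0 == ord0 then x.1 else x.2).
have invE x b y : inv0 x b y =
  act y.1 (if sval y.2 ord0 == ord0 then x.1 else x.2) by [].
have inv_nat x b c (f : hom b c) y : inv0 x b (act f y) = act f (inv0 x c y).
  case: y => u y; rewrite !invE /= act_comp ffunE; do 2 congr act.
  by rewrite [y]bdE /= !ffunE.
pose inv x : expo D X (boundary 1) a := PsMap (inv_nat x).
exists inv => [h | [x y]]; last first.
  by congr pair; rewrite /= invE /= ffunE act_id.
apply: psmap_eq => b [u y]; rewrite /= invE /=.
have uE : @act _ T _ _ u (idm a, bdvertex (sval y ord0) (D a)) = (u, y).
  congr pair; first exact: comp_idl.
  by rewrite [RHS](bdE (D b) y); apply: bdvertex_act.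
rewrite -[in RHS]uE psnat.
congr act; case: (sval y ord0) => [[|[|//]] i] /=.
  by congr (h a (_, bdvertex _ _)); apply: val_inj.
by congr (h a (_, bdvertex _ _)); apply: val_inj.
Qed.

Definition path_ends (C : category) (D : functor C Delta) (X : presheaf C) :
    psmap (expo D X (stdsimplex 1)) (psprod X X) :=
  pscomp (expo_boundary D X)
    (expo_map D X (subpresheaf_incl (@boundary_act 1))).

Record pointed (C : category) := Pointed {
  pobj :> presheaf C;
  point : psmap (final C) pobj }.

Definition Omega (C : category) (D : functor C Delta) (X : pointed C) :
    presheaf C :=
  pullback (path_ends D X) (pspair (point X) (point X)).

Definition infinite_loop_space (C : category) (D : functor C Delta)
    (B : nat -> pointed C) : Prop :=
  (forall i, s_fibrant D (B i)) /\
  (forall i, exists f : psmap (B i) (Omega D (B i.+1)), weak_s_equivalence D f).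

(* By the Yoneda lemma the objects of Delta[P] are the simplices of N(P). *)
Record simplex (d : Order.disp_t) (P : porderType d) := Simplex {
  sdim : nat;
  svert :> nerve P sdim }.

Record simplex_hom (d : Order.disp_t) (P : porderType d) (s t : simplex P) :=
  SimplexHom {
    shom :> nerve 'I_(sdim t).+1 (sdim s);
    shom_over : ncomp t shom = s }.

Lemma simplex_hom_eq (d : Order.disp_t) (P : porderType d) (s t : simplex P)
    (f g : simplex_hom s t) : (forall i, f i = g i) -> f = g.
Proof.
case: f g => [f fE] [g gE] /= fg; have {}fg : f = g by apply: nerveP.
by case: _ / fg gE => gE; congr SimplexHom; apply: Prop_irrelevance.
Qed.

Lemma simplex_homE (d : Order.disp_t) (P : porderType d) (s t : simplex P)
    (f : simplex_hom s t) i : t (f i) = s i.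
Proof. by rewrite -[in RHS](shom_over f) ffunE. Qed.

Program Definition simplex_id (d : Order.disp_t) (P : porderType d)
    (s : simplex P) : simplex_hom s s := @SimplexHom d P s s (nid (sdim s)) _.
Next Obligation. by move=> *; apply: nerveP => i; rewrite !ffunE. Qed.

Program Definition simplex_comp (d : Order.disp_t) (P : porderType d)
    (s t u : simplex P) (g : simplex_hom t u) (f : simplex_hom s t) :
    simplex_hom s u := @SimplexHom d P s u (ncomp g f) _.
Next Obligation.
by move=> *; apply: nerveP => i; rewrite !ffunE !simplex_homE.
Qed.

Program Definition DeltaP (d : Order.disp_t) (P : porderType d) : category :=
  @Category (simplex P) (@simplex_hom d P) (@simplex_id d P)
    (@simplex_comp d P) _ _ _.
Next Obligation. by move=> *; apply: simplex_hom_eq => i; rewrite !ffunE. Qed.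
Next Obligation. by move=> *; apply: simplex_hom_eq => i; rewrite !ffunE. Qed.
Next Obligation. by move=> *; apply: simplex_hom_eq => i; rewrite !ffunE. Qed.

Program Definition dimP (d : Order.disp_t) (P : porderType d) :
    functor (DeltaP P) Delta :=
  @Functor (DeltaP P) Delta (@sdim d P) (fun s t f => f) _ _.
Next Obligation. by []. Qed.
Next Obligation. by []. Qed.

Definition maximal (d : Order.disp_t) (P : porderType d) (x : P) : Prop :=
  forall y : P, (x <= y)%O -> y = x.

Definition regular (d : Order.disp_t) (P : porderType d) (s : simplex P) : Prop :=
  maximal (s ord_max).

Definition DeltaPreg (d : Order.disp_t) (P : porderType d) : category :=
  full (C := DeltaP P) (@regular d P).

Definition DeltaPreg_incl (d : Order.disp_t) (P : porderType d) :
    functor (DeltaPreg P) (DeltaP P) := full_incl (C := DeltaP P) (@regular d P).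

Definition dimPreg (d : Order.disp_t) (P : porderType d) :
    functor (DeltaPreg P) Delta := functor_comp (dimP P) (DeltaPreg_incl P).

Record perversity (d : Order.disp_t) (P : porderType d) := Perversity {
  pervfun :> P -> \bar int;
  perv_maximal : forall x, maximal x -> pervfun x = 0%:E }.

(* Blown-up cochains on s = s_0^[q_0] < ... < s_l^[q_l]: the basis element
   1_(F,e) is encoded by the set of all vertices of (F_0,e_0), ..., (F_l,e_l),
   where [inl i] stands for the i-th vertex of s and [inr x] for the apex of
   the cone over the block of s lying over x. *)

(* The increasing sequence s_0, ..., s_l. *)
Definition strata (d : Order.disp_t) (P : porderType d) (s : simplex P) : seq P :=
  undup (codom s).

Notation bvertex s := ('I_(sdim s).+1 + seq_sub (strata s))%type.

Definition stratum (d : Order.disp_t) (P : porderType d) (s : simplex P)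
    (v : bvertex s) : P :=
  match v with inl i => s i | inr x => ssval x end.

Definition is_apex (d : Order.disp_t) (P : porderType d) (s : simplex P)
    (v : bvertex s) : bool := if v is inr _ then true else false.

(* The order of the vertices of a cone; the apex is the last one. *)
Definition vertex_lt (d : Order.disp_t) (P : porderType d) (s : simplex P)
    (v w : bvertex s) : bool :=
  match v, w with
  | inl i, inl j => (i < j)%N
  | inl _, inr _ => true
  | inr _, _ => false
  end.

Definition block (d : Order.disp_t) (P : porderType d) (s : simplex P)
    (c : {set bvertex s}) (x : P) : {set bvertex s} :=
  [set v in c | stratum v == x].

(* All the (F_i,e_i) are non-empty, and the last block is not coned. *)
Definition is_cell (d : Order.disp_t) (P : porderType d) (s : simplex P)
    (c : {set bvertex s}) : bool :=
  all (fun x => block c x != set0) (strata s) &&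
  ~~ [exists v in block c (s ord_max), is_apex v].

Definition face_dim (d : Order.disp_t) (P : porderType d) (s : simplex P)
    (c : {set bvertex s}) (x : P) : nat := #|block c x|.-1.

Definition cell_dim (d : Order.disp_t) (P : porderType d) (s : simplex P)
    (c : {set bvertex s}) : nat := (\sum_(x <- strata s) face_dim c x)%N.

Definition cell (d : Order.disp_t) (P : porderType d) (s : simplex P) (n : nat) :=
  {c : {set bvertex s} | is_cell c && (cell_dim c == n)}.

(* The elements of degree n, given by their coordinates in the basis 1_(F,e). *)
Definition cochain (R : comPzRingType) (d : Order.disp_t) (P : porderType d)
    (s : simplex P) (n : nat) := {ffun cell s n -> R}.

(* The coordinate of index c, 0 if c is not a cell of dimension n. *)
Definition coord (R : comPzRingType) (d : Order.disp_t) (P : porderType d)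
    (s : simplex P) (n : nat) (w : cochain R s n) (c : {set bvertex s}) : R :=
  oapp w 0 (insub c).

(* If v is the j-th vertex of F_i, this is (dim F_0 + ... + dim F_(i-1)) + j. *)
Definition sign_exponent (d : Order.disp_t) (P : porderType d) (s : simplex P)
    (c : {set bvertex s}) (v : bvertex s) : nat :=
  ((\sum_(x <- strata s | (x < stratum v)%O) face_dim c x) +
   #|[set u in block c (stratum v) | vertex_lt u v]|)%N.

(* The differential of the tensor product, with the Koszul sign rule, where
   N^*(Delta[q]) has the differential (delta f)(x) = \sum_j (-1)^j f(d_j x).
   When v is the only vertex of its block, [c :\ v] is not a cell and its
   coordinate is 0. *)
Definition coboundary (R : comPzRingType) (d : Order.disp_t) (P : porderType d)
    (s : simplex P) (n : nat) (w : cochain R s n) : cochain R s n.+1 :=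
  [ffun c : cell s n.+1 => \sum_(v in val c)
     (-1) ^+ sign_exponent (val c) v * coord w (val c :\ v)].

(* As s_0 < ... < s_l, the blocks after that of x are those over y > x. *)
Definition perverse_degree_cell (d : Order.disp_t) (P : porderType d)
    (s : simplex P) (c : {set bvertex s}) (x : P) : \bar int :=
  if x == s ord_max then 0%:E
  else if (x \in strata s) && ~~ [exists v in block c x, is_apex v]
  then ((\sum_(y <- strata s | (x < y)%O) face_dim c y)%N%:Z)%:E
  else -oo%E.

Definition perverse_degree (R : comPzRingType) (d : Order.disp_t)
    (P : porderType d) (s : simplex P) (n : nat) (w : cochain R s n) (x : P) :
    \bar int :=
  \big[Order.max/-oo%E]_(c : cell s n | w c != 0) perverse_degree_cell (val c) x.

Definition allowable (R : comPzRingType) (d : Order.disp_t) (P : porderType d)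
    (p : perversity P) (s : simplex P) (n : nat) (w : cochain R s n) : Prop :=
  forall x, (perverse_degree w x <= p x)%O.

(* Membership in the degree n part of the complex of s, which is 0 when s is
   not regular. *)
Definition Ntilde (R : comPzRingType) (d : Order.disp_t) (P : porderType d)
    (p : perversity P) (s : simplex P) (n : nat) (w : cochain R s n) : Prop :=
  (regular s -> allowable p w /\ allowable p (coboundary w)) /\
  (~ regular s -> w = 0).

Lemma strataP (d : Order.disp_t) (P : porderType d) (s : simplex P) x :
  reflect (exists i, s i = x) (x \in strata s).
Proof.
rewrite mem_undup; apply: (iffP codomP) => [[i ->]|[i <-]]; by exists i.
Qed.

Lemma strata_sub (d : Order.disp_t) (P : porderType d) (s t : simplex P)
  (f : simplex_hom s t) x : x \in strata s -> x \in strata t.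
Proof.
by case/strataP => i <-; apply/strataP; exists (f i); rewrite simplex_homE.
Qed.

Definition bvertex_map (d : Order.disp_t) (P : porderType d) (s t : simplex P)
    (f : simplex_hom s t) (v : bvertex s) : bvertex t :=
  match v with
  | inl i => inl (f i)
  | inr x => inr (SeqSub (strata_sub f (ssvalP x)))
  end.

(* The image of a cell; over the strata of t which do not occur in s it
   consists of the apex. *)
Definition cell_map (d : Order.disp_t) (P : porderType d) (s t : simplex P)
    (f : simplex_hom s t) (c : {set bvertex s}) : {set bvertex t} :=
  bvertex_map f @: c :|:
  [set inr x | x : seq_sub (strata t) & ssval x \notin strata s].

(* When f is not injective on c, the image of c is degenerate: it is not a
   cell of dimension n and its coordinate is 0, as it should be for normalized
   cochains. *)
Definition cochain_map (R : comPzRingType) (d : Order.disp_t) (P : porderType d)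
    (s t : simplex P) (f : simplex_hom s t) (n : nat) (w : cochain R t n) :
    cochain R s n :=
  [ffun c : cell s n => coord w (cell_map f (val c))].

Lemma coordE (R : comPzRingType) (d : Order.disp_t) (P : porderType d)
    (s : simplex P) n (w : cochain R s n) (c : cell s n) : coord w (val c) = w c.
Proof. by rewrite /coord valK. Qed.

Lemma coord_out (R : comPzRingType) (d : Order.disp_t) (P : porderType d)
    (s : simplex P) n (w : cochain R s n) (c : {set bvertex s}) :
  ~~ (is_cell c && (cell_dim c == n)) -> coord w c = 0.
Proof. by move=> cN; rewrite /coord insubN. Qed.

Lemma coord0 (R : comPzRingType) (d : Order.disp_t) (P : porderType d)
    (s : simplex P) n (c : {set bvertex s}) : coord (0 : cochain R s n) c = 0.
Proof. by rewrite /coord; case: insub => //= c'; rewrite ffunE. Qed.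

Lemma stratum_map (d : Order.disp_t) (P : porderType d) (s t : simplex P)
  (f : simplex_hom s t) v : stratum (bvertex_map f v) = stratum v.
Proof. by case: v => [i|x] //=; apply: simplex_homE. Qed.

Lemma stratum_in (d : Order.disp_t) (P : porderType d) (s : simplex P)
  (v : bvertex s) : stratum v \in strata s.
Proof. by case: v => [i|[x xP]] //=; apply/strataP; exists i. Qed.

Lemma top_in (d : Order.disp_t) (P : porderType d) (s : simplex P) :
  s ord_max \in strata s.
Proof. by apply/strataP; exists ord_max. Qed.

Lemma is_apex_map (d : Order.disp_t) (P : porderType d) (s t : simplex P)
  (f : simplex_hom s t) v : is_apex (bvertex_map f v) = is_apex v.
Proof. by case: v. Qed.

Lemma block_map (d : Order.disp_t) (P : porderType d) (s t : simplex P)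
    (f : simplex_hom s t) (c : {set bvertex s}) x : x \in strata s ->
  block (cell_map f c) x = bvertex_map f @: block c x.
Proof.
move=> xs; apply/setP => v; apply/idP/imsetP.
  rewrite !inE => /andP[/orP[/imsetP[u uc ->]|/imsetP[y]]].
    by rewrite stratum_map => ux; exists u; rewrite // inE uc.
  by rewrite inE => ys -> /= /eqP yx; rewrite yx xs in ys.
case=> u; rewrite inE => /andP[uc ux] ->.
by rewrite !inE stratum_map ux andbT imset_f.
Qed.

Lemma block_map_new (d : Order.disp_t) (P : porderType d) (s t : simplex P)
    (f : simplex_hom s t) (c : {set bvertex s}) x (xt : x \in strata t) : x \notin strata s ->
  block (cell_map f c) x = [set inr (SeqSub xt)].
Proof.
move=> xs; apply/setP => v; rewrite !inE; apply/idP/eqP => [|->].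
  case/andP => /orP[/imsetP[u uc ->]|/imsetP[y]].
    by rewrite stratum_map => /eqP ux; rewrite -ux stratum_in in xs.
  by move=> _ -> /= /eqP yx; congr inr; apply: val_inj.
by rewrite /= eqxx andbT; apply/orP; right; apply/imsetP; exists (SeqSub xt);
   rewrite ?inE.
Qed.

Lemma big_strata_map (d : Order.disp_t) (P : porderType d) (s t : simplex P)
    (f : simplex_hom s t) (Q : pred P) (F : P -> nat) :
  (forall x, x \notin strata s -> F x = 0%N) ->
  (\sum_(x <- strata t | Q x) F x = \sum_(x <- strata s | Q x) F x)%N.
Proof.
move=> F0; rewrite (bigID (mem (strata s))) /= [X in (_ + X)%N]big1 ?addn0;
  last by move=> x /andP[_ /F0].
rewrite -big_filter -[RHS]big_filter; apply: perm_big.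
apply: uniq_perm; rewrite ?filter_uniq ?undup_uniq // => x.
rewrite !mem_filter -andbA; congr (_ && _).
by apply/andP/idP => [[]|xs] //; split=> //; apply: strata_sub xs.
Qed.

Lemma face_dim_map_new (d : Order.disp_t) (P : porderType d) (s t : simplex P)
    (f : simplex_hom s t) (c : {set bvertex s}) x : x \notin strata s ->
  face_dim (cell_map f c) x = 0%N.
Proof.
move=> xs; rewrite /face_dim; have [xt|xt] := boolP (x \in strata t).
  by rewrite (block_map_new f c xt xs) cards1.
suff -> : block (cell_map f c) x = set0 by rewrite cards0.
apply/setP => v; rewrite !inE; apply/negP => /andP[_ /eqP vx].
by rewrite -vx stratum_in in xt.
Qed.

Lemma face_dim_map (d : Order.disp_t) (P : porderType d) (s t : simplex P)
    (f : simplex_hom s t) (c : {set bvertex s}) x : (face_dim (cell_map f c) x <= face_dim c x)%N.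
Proof.
have [xs|xs] := boolP (x \in strata s); last by rewrite face_dim_map_new.
rewrite /face_dim block_map //.
by rewrite -!subn1 leq_sub2r // leq_imset_card.
Qed.

Lemma face_dim_map_inj (d : Order.disp_t) (P : porderType d) (s t : simplex P)
    (f : simplex_hom s t) (c : {set bvertex s}) x : x \in strata s ->
  {in c &, injective (bvertex_map f)} ->
  face_dim (cell_map f c) x = face_dim c x.
Proof.
move=> xs f_inj; rewrite /face_dim block_map // card_in_imset // => u v.
by rewrite !inE => /andP[uc _] /andP[vc _]; apply: f_inj.
Qed.

Lemma cell_dim_mapE (d : Order.disp_t) (P : porderType d) (s t : simplex P)
    (f : simplex_hom s t) (c : {set bvertex s}) :
  cell_dim (cell_map f c) = (\sum_(x <- strata s) face_dim (cell_map f c) x)%N.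
Proof. by apply: big_strata_map => // x; apply: face_dim_map_new. Qed.

Lemma cell_dim_map (d : Order.disp_t) (P : porderType d) (s t : simplex P)
    (f : simplex_hom s t) (c : {set bvertex s}) : (cell_dim (cell_map f c) <= cell_dim c)%N.
Proof. by rewrite cell_dim_mapE; apply: leq_sum => x _; apply: face_dim_map. Qed.

Lemma cell_dim_map_eq (d : Order.disp_t) (P : porderType d) (s t : simplex P)
    (f : simplex_hom s t) (c : {set bvertex s}) : {in c &, injective (bvertex_map f)} ->
  cell_dim (cell_map f c) = cell_dim c.
Proof.
move=> f_inj; rewrite cell_dim_mapE; apply: eq_big_seq => x xs.
exact: face_dim_map_inj.
Qed.

Lemma eq_sum_leq (I : eqType) (r : seq I) (F G : I -> nat) :
  (forall i, F i <= G i)%N -> (\sum_(i <- r) F i = \sum_(i <- r) G i)%N ->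
  {in r, forall i, F i = G i}.
Proof.
move=> FG; elim: r => [|j r IH] //; rewrite !big_cons => FGr.
have le_r : (\sum_(i <- r) F i <= \sum_(i <- r) G i)%N by apply: leq_sum.
have Fj : F j = G j.
  by apply/eqP; rewrite eqn_leq FG /= -(leq_add2r (\sum_(i <- r) F i)) FGr leq_add2l.
move=> i; rewrite inE => /orP[/eqP -> //|ir]; apply: IH => //.
by move/eqP: FGr; rewrite Fj eqn_add2l => /eqP.
Qed.

Lemma cell_map_inj (d : Order.disp_t) (P : porderType d) (s t : simplex P)
    (f : simplex_hom s t) (c : {set bvertex s}) : is_cell c ->
  cell_dim (cell_map f c) = cell_dim c -> {in c &, injective (bvertex_map f)}.
Proof.
move=> /andP[/allP c0 _]; rewrite cell_dim_mapE => /eq_sum_leq eq_dim u v uc vc fuv.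
have uv : stratum v = stratum u by rewrite -(stratum_map f) -fuv stratum_map.
have us := stratum_in u.
have {eq_dim} := eq_dim (fun x => face_dim_map f c x) _ us.
rewrite /face_dim block_map // => eq_card.
have /imset_injP f_inj : #|bvertex_map f @: block c (stratum u)| ==
    #|block c (stratum u)|.
  have := c0 _ us; rewrite -card_gt0.
  have : (0 < #|bvertex_map f @: block c (stratum u)|)%N.
    by apply/card_gt0P; exists (bvertex_map f u); rewrite imset_f // inE uc eqxx.
  by move=> fc_gt0 c_gt0; rewrite -(prednK fc_gt0) -(prednK c_gt0) eq_card.
by apply: f_inj; rewrite ?inE ?uc ?vc ?uv ?eqxx.
Qed.

Lemma is_cell_map (d : Order.disp_t) (P : porderType d) (s t : simplex P)
    (f : simplex_hom s t) (c : {set bvertex s}) : s ord_max = t ord_max ->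
  is_cell (cell_map f c) = is_cell c.
Proof.
move=> st; rewrite /is_cell -st block_map ?top_in //; congr (_ && ~~ _).
  apply/allP/allP => [fc0 x xs | c0 x xt].
    have := fc0 _ (strata_sub f xs); rewrite block_map // -!card_gt0.
    by case/card_gt0P => v /imsetP[u uc _]; apply/card_gt0P; exists u.
  have [xs|xs] := boolP (x \in strata s).
    have := c0 _ xs; rewrite block_map // -!card_gt0 => /card_gt0P[v vc].
    by apply/card_gt0P; exists (bvertex_map f v); rewrite imset_f.
  by rewrite (block_map_new f c xt xs) -card_gt0 cards1.
apply/existsP/existsP => [[v /andP[/imsetP[u uc ->]]] | [u /andP[uc ua]]].
  by rewrite is_apex_map => ua; exists u; rewrite uc.
by exists (bvertex_map f u); rewrite imset_f ?is_apex_map.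
Qed.

Lemma regular_hom (d : Order.disp_t) (P : porderType d) (s t : simplex P)
    (f : simplex_hom s t) : regular s -> s ord_max = t ord_max.
Proof.
move=> s_reg; apply/esym/s_reg; rewrite -(simplex_homE f).
by apply: chain_le; apply: leq_ord.
Qed.

Lemma cell_map_id (d : Order.disp_t) (P : porderType d) (s : simplex P)
    (c : {set bvertex s}) : cell_map (simplex_id s) c = c.
Proof.
apply/setP => v; rewrite inE; apply/orP/idP => [[|]|vc].
- case/imsetP => [[i|x] uc ->] /=; first by rewrite ffunE.
  by move: uc; congr (inr _ \in c); apply: val_inj.
- by case/imsetP => x; rewrite inE ssvalP.
- left; apply/imsetP; exists v => //; case: v vc => [i|x] vc /=.
    by rewrite ffunE.
  by congr inr; apply: val_inj.
Qed.

Lemma bvertex_map_comp (d : Order.disp_t) (P : porderType d) (s t u : simplex P)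
    (g : simplex_hom t u) (f : simplex_hom s t) v :
  bvertex_map (simplex_comp g f) v = bvertex_map g (bvertex_map f v).
Proof. by case: v => [i|x] /=; [rewrite ffunE | congr inr; apply: val_inj]. Qed.

Lemma cell_map_comp (d : Order.disp_t) (P : porderType d) (s t u : simplex P)
    (g : simplex_hom t u) (f : simplex_hom s t) (c : {set bvertex s}) :
  cell_map (simplex_comp g f) c = cell_map g (cell_map f c).
Proof.
apply/setP => v; rewrite !inE; apply/orP/orP => [[|]|[|]].
- case/imsetP => w wc ->; left; rewrite bvertex_map_comp imset_f //.
  by rewrite inE imset_f.
- case/imsetP => x; rewrite inE => xs ->.
  have [xt|xt] := boolP (ssval x \in strata t); last first.
    by right; apply/imsetP; exists x; rewrite ?inE.
  left; apply/imsetP; exists (inr (SeqSub xt)).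
    by rewrite inE; apply/orP; right; apply/imsetP; exists (SeqSub xt); rewrite ?inE.
  by congr inr; apply: val_inj.
- case/imsetP => w; rewrite inE => /orP[/imsetP[w' wc ->] ->|/imsetP[x]].
    by left; rewrite -bvertex_map_comp imset_f.
  rewrite inE => xs -> ->; right; apply/imsetP.
  by exists (SeqSub (strata_sub g (ssvalP x))); rewrite ?inE.
- case/imsetP => x; rewrite inE => xt ->; right; apply/imsetP; exists x => //.
  by rewrite inE; apply: contra xt; apply: strata_sub.
Qed.

Lemma cochain_map_id (R : comPzRingType) (d : Order.disp_t) (P : porderType d)
    (s : simplex P) n (w : cochain R s n) : cochain_map (simplex_id s) w = w.
Proof. by apply/ffunP => c; rewrite ffunE cell_map_id coordE. Qed.

Lemma cochain_map0 (R : comPzRingType) (d : Order.disp_t) (P : porderType d)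
    (s t : simplex P) (f : simplex_hom s t) n :
  cochain_map f (0 : cochain R t n) = 0.
Proof. by apply/ffunP => c; rewrite !ffunE coord0. Qed.

Lemma coord_cochain_map (R : comPzRingType) (d : Order.disp_t)
    (P : porderType d) (s t : simplex P) (f : simplex_hom s t) n
    (w : cochain R t n) (c : {set bvertex s}) : is_cell c -> (cell_dim c <= n)%N ->
  coord (cochain_map f w) c = coord w (cell_map f c).
Proof.
move=> cc; rewrite leq_eqVlt => /predU1P[cn|cn].
  have cP : is_cell c && (cell_dim c == n) by rewrite cc cn eqxx.
  by rewrite [c]/(val (exist _ c cP : cell s n)) coordE ffunE.
have fcn := leq_ltn_trans (cell_dim_map f c) cn.
by rewrite !coord_out // ltn_eqF ?andbF.
Qed.

Lemma cochain_map_comp (R : comPzRingType) (d : Order.disp_t)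
    (P : porderType d) (s t u : simplex P) (g : simplex_hom t u)
    (f : simplex_hom s t) n (w : cochain R u n) : s ord_max = t ord_max ->
  cochain_map (simplex_comp g f) w = cochain_map f (cochain_map g w).
Proof.
move=> st; apply/ffunP => -[c cP]; rewrite !ffunE /= cell_map_comp.
case/andP: cP => cc /eqP cn; rewrite coord_cochain_map ?is_cell_map //.
by rewrite -cn cell_dim_map.
Qed.

Lemma coboundaryE (R : comPzRingType) (d : Order.disp_t) (P : porderType d)
    (s : simplex P) n (w : cochain R s n) (c : {set bvertex s}) :
  is_cell c -> cell_dim c = n.+1 ->
  coord (coboundary w) c =
    \sum_(v in c) (-1) ^+ sign_exponent c v * coord w (c :\ v).
Proof.
move=> cc cn; have cP : is_cell c && (cell_dim c == n.+1) by rewrite cc cn eqxx.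
by rewrite [c]/(val (exist _ c cP : cell s n.+1)) coordE ffunE.
Qed.

Lemma face_dimD1 (d : Order.disp_t) (P : porderType d) (s : simplex P)
    (c : {set bvertex s}) v : v \in c -> is_cell (c :\ v) ->
  (cell_dim (c :\ v)).+1 = cell_dim c.
Proof.
move=> vc /andP[/allP c0 _]; have vs := stratum_in v.
rewrite /cell_dim !(bigD1_seq (stratum v)) ?undup_uniq //= -addSn.
congr addn; last first.
  apply: eq_bigr => x xv; rewrite /face_dim; congr predn; apply: eq_card => u.
  rewrite !inE; case: eqP => //= ->.
  by rewrite eq_sym (negPf xv) andbF.
have := c0 _ vs; rewrite -card_gt0 /face_dim => card_gt.
rewrite (prednK card_gt) (cardsD1 v (block c _)) inE vc eqxx /=.
by apply: eq_card => u; rewrite !inE andbA.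
Qed.

Lemma coord_face_map (R : comPzRingType) (d : Order.disp_t) (P : porderType d)
    (s t : simplex P) (f : simplex_hom s t) n (w : cochain R t n)
    (c : {set bvertex s}) v : s ord_max = t ord_max -> v \in c ->
  cell_dim c = n.+1 ->
  coord (cochain_map f w) (c :\ v) = coord w (cell_map f (c :\ v)).
Proof.
move=> st vc cn; have [cv|cv] := boolP (is_cell (c :\ v)).
  by rewrite coord_cochain_map // -ltnS face_dimD1 // cn.
by rewrite !coord_out // ?is_cell_map // (negPf cv).
Qed.

Lemma coord_face_neq0 (R : comPzRingType) (d : Order.disp_t) (P : porderType d)
    (s t : simplex P) (f : simplex_hom s t) n (w : cochain R t n)
    (c : {set bvertex s}) v : s ord_max = t ord_max -> v \in c ->
  cell_dim c = n.+1 -> coord w (cell_map f (c :\ v)) != 0 ->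
  {in c :\ v &, injective (bvertex_map f)}.
Proof.
move=> st vc cn wN0.
have /andP[fcv /eqP fn] : is_cell (cell_map f (c :\ v)) &&
    (cell_dim (cell_map f (c :\ v)) == n).
  by apply: contraNT wN0 => /(coord_out w) ->.
rewrite is_cell_map // in fcv; apply: cell_map_inj => //; rewrite fn.
by have := face_dimD1 vc fcv; rewrite cn => -[].
Qed.

Lemma cell_map_face (d : Order.disp_t) (P : porderType d) (s t : simplex P)
    (f : simplex_hom s t) (c : {set bvertex s}) v :
  {in c &, injective (bvertex_map f)} -> v \in c ->
  cell_map f c :\ bvertex_map f v = cell_map f (c :\ v).
Proof.
move=> f_inj vc; apply/setP => u; rewrite !inE.
apply/andP/orP => [[uv /orP[/imsetP[u' uc uE]|uN]] | [/imsetP[u' uc ->]|uN]].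
- left; apply/imsetP; exists u' => //; rewrite !inE uc andbT.
  by apply: contraNneq uv => <-; rewrite uE.
- by right.
- move: uc; rewrite !inE => /andP[uv uc]; split.
    by apply: contraNneq uv => /f_inj ->.
  by rewrite imset_f.
- split; last by rewrite uN orbT.
  case/imsetP: uN => x; rewrite inE => xs ->.
  apply: contraNneq xs => /(congr1 (@stratum _ _ t)); rewrite stratum_map /= => ->.
  exact: stratum_in.
Qed.

Lemma vertex_lt_map (d : Order.disp_t) (P : porderType d) (s t : simplex P)
    (f : simplex_hom s t) (c : {set bvertex s}) u v :
  {in c &, injective (bvertex_map f)} -> u \in c -> v \in c ->
  vertex_lt (bvertex_map f u) (bvertex_map f v) = vertex_lt u v.
Proof.
case: u v => [i|x] [j|y] //= f_inj ic jc.
have [ij|ji] := ltnP i j; last first.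
  by apply/negbTE; rewrite -leqNgt; apply: (chain_le f).
rewrite ltn_neqAle (chain_le f (ltnW ij) : (_ <= _)%N) andbT.
apply: contraTneq ij => /val_inj fij.
by have [->] := f_inj _ _ ic jc (congr1 inl fij); rewrite ltnn.
Qed.

Lemma sign_exponent_map (d : Order.disp_t) (P : porderType d) (s t : simplex P)
    (f : simplex_hom s t) (c : {set bvertex s}) v :
  {in c &, injective (bvertex_map f)} -> v \in c ->
  sign_exponent (cell_map f c) (bvertex_map f v) = sign_exponent c v.
Proof.
move=> f_inj vc; rewrite /sign_exponent stratum_map; congr addn.
  rewrite (big_strata_map f) => [|x]; last exact: face_dim_map_new.
  rewrite big_seq_cond [RHS]big_seq_cond; apply: eq_bigr => x /andP[xs _].
  exact: face_dim_map_inj.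
rewrite block_map ?stratum_in //.
rewrite -(card_in_imset (f := bvertex_map f)); last first.
  by move=> x y; rewrite !inE => /andP[/andP[xc _] _] /andP[/andP[yc _] _]; apply: f_inj.
apply: eq_card => u; rewrite !inE; apply/andP/imsetP => [[/imsetP[u' uc ->]] | [u' uc ->]].
  move: uc; rewrite inE => /andP[uc uv]; rewrite (vertex_lt_map f_inj) // => uv'.
  by exists u'; rewrite // !inE uc uv.
move: uc; rewrite !inE => /andP[/andP[uc uv] u_lt]; split.
  by rewrite imset_f // inE uc.
by rewrite (vertex_lt_map f_inj).
Qed.

Lemma sign_exponent_fold (d : Order.disp_t) (P : porderType d) (s t : simplex P)
    (f : simplex_hom s t) (c : {set bvertex s}) u v :
  u \in c -> v \in c -> bvertex_map f u = bvertex_map f v -> vertex_lt u v ->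
  (forall x, x \in c -> bvertex_map f x = bvertex_map f u -> x = u \/ x = v) ->
  sign_exponent c v = (sign_exponent c u).+1.
Proof.
move=> uc vc fuv uv only.
have suv : stratum u = stratum v by rewrite -(stratum_map f) fuv stratum_map.
rewrite /sign_exponent suv -addnS; congr addn.
case: u v fuv uv only suv uc vc => [i|x] [j|y] //= [fij] ij only sij ic jc.
rewrite (cardsD1 (inl i)) !inE ic /= sij eqxx ij /= add1n; congr S.
apply: eq_card => -[k|z]; rewrite !inE /= ?andbF //.
have -> : (inl k != inl i :> bvertex s) = (k != i) by [].
have [kc|kc] := boolP (inl k \in c); last by rewrite !andbF.
have [_|_] := boolP (s k == s j); last by rewrite !andbF.
rewrite /=; have [ki|ik|ki] := ltngtP k i.
- by rewrite (ltn_trans ki ij) andbT; apply: contraTneq ki => ->; rewrite ltnn.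
- apply/negP => /andP[_ kj].
  have fk : f k = f i.
    apply: val_inj; apply/eqP; rewrite eqn_leq; apply/andP; split.
      by rewrite fij; apply: (chain_le f); apply: ltnW.
    by apply: (chain_le f); apply: ltnW.
  case: (only _ kc (congr1 inl fk)) => -[kE].
    by rewrite kE ltnn in ik.
  by rewrite kE ltnn in kj.
- by rewrite (val_inj ki) eqxx.
Qed.

Lemma cell_map_fold (d : Order.disp_t) (P : porderType d) (s t : simplex P)
    (f : simplex_hom s t) (c : {set bvertex s}) u v :
  u \in c -> v \in c -> u != v -> bvertex_map f u = bvertex_map f v ->
  cell_map f (c :\ u) = cell_map f (c :\ v).
Proof.
move=> uc vc uv fuv; congr setU; apply/setP => x.
apply/imsetP/imsetP => -[y]; rewrite !inE => /andP[yN yc] ->.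
  have [->|yv] := eqVneq y v; last by exists y; rewrite // !inE yv.
  by exists u; rewrite // !inE uv.
have [->|yu] := eqVneq y u; last by exists y; rewrite // !inE yu.
by exists v; rewrite // !inE eq_sym uv.
Qed.

Lemma cochain_map_coboundary (R : comPzRingType) (d : Order.disp_t)
    (P : porderType d) (s t : simplex P) (f : simplex_hom s t) n
    (w : cochain R t n) : s ord_max = t ord_max ->
  cochain_map f (coboundary w) = coboundary (cochain_map f w).
Proof.
move=> st; apply/ffunP => -[c cP]; rewrite !ffunE /=.
case/andP: (cP) => cc /eqP cn.
under [RHS]eq_bigr => v vc do rewrite coord_face_map //.
have fcc : is_cell (cell_map f c) by rewrite is_cell_map.
have [fcn|fcn] := eqVneq (cell_dim (cell_map f c)) n.+1.
  have f_inj : {in c &, injective (bvertex_map f)}.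
    by apply: cell_map_inj; rewrite // fcn.
  rewrite coboundaryE //.
  rewrite (bigID (mem (bvertex_map f @: c))) /= [X in _ + X]big1 ?addr0; last first.
    move=> v /andP[]; rewrite inE => /orP[-> //|/imsetP[x]].
    rewrite inE => xs -> _; rewrite coord_out ?mulr0 // negb_and; apply/orP; left.
    rewrite negb_and; apply/orP; left; apply/allPn; exists (ssval x); rewrite ?ssvalP //.
    rewrite negbK; apply/eqP/setP => u; rewrite !inE.
    apply/negP => /andP[/andP[ux uc] /eqP uE].
    have : u \in block (cell_map f c) (ssval x) by rewrite !inE uE eqxx andbT.
    rewrite (block_map_new f c (ssvalP x) xs) inE => /eqP uE'.
    by move/negP: ux; apply; rewrite uE'; apply/eqP; congr inr; apply: val_inj.
  rewrite (eq_bigl [in bvertex_map f @: c]); last first.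
    by move=> v; apply: andb_idl => /= vi; rewrite inE vi.
  rewrite big_imset //=; apply: eq_bigr => v vc.
  by rewrite sign_exponent_map // cell_map_face.
rewrite coord_out; last by rewrite (negPf fcn) andbF.
have [/existsP[v /andP[vc wv]] | /existsPn w0] := boolP [exists v,
    (v \in c) && (coord w (cell_map f (c :\ v)) != 0)]; last first.
  rewrite big1 // => v vc; have := w0 v; rewrite vc /= negbK => /eqP ->.
  by rewrite mulr0.
have f_inj := coord_face_neq0 st vc cn wv.
have [u /and3P[uc uv /eqP fuv]] : exists u,
    [&& u \in c, u != v & bvertex_map f u == bvertex_map f v].
  apply/existsP; apply: contra_neqT fcn => /existsPn uN.
  rewrite -cn; apply: cell_dim_map_eq => x y xc yc fxy.
  have [xv|xv] := eqVneq x v.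
    by have := uN y; rewrite yc -xv -fxy eqxx andbT /= negbK => /eqP.
  have [yv|yv] := eqVneq y v.
    by have := uN x; rewrite xc xv -yv fxy eqxx.
  by apply: f_inj; rewrite ?inE ?xv ?yv.
have only x : x \in c -> bvertex_map f x = bvertex_map f u -> x = u \/ x = v.
  move=> xc fxu; have [->|xv] := eqVneq x v; [by right | left].
  by apply: f_inj; rewrite ?inE ?xv ?uv.
rewrite (bigD1 v) // (bigD1 u) /=; last by rewrite uc.
rewrite big1 ?addr0 => [|x /andP[/andP[xc xv] xu]]; last first.
  have [->|wx] := eqVneq (coord w (cell_map f (c :\ x))) 0; first by rewrite mulr0.
  have := coord_face_neq0 st xc cn wx.
  move/(_ u v); rewrite !inE uc vc ![_ == x]eq_sym xu xv => /(_ isT isT fuv) uE.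
  by rewrite uE eqxx in uv.
rewrite (cell_map_fold uc vc uv fuv) -mulrDl.
have [u_lt|u_ge] := boolP (vertex_lt u v).
  rewrite (sign_exponent_fold uc vc fuv u_lt only).
  by rewrite exprS mulN1r addNr mul0r.
have v_lt : vertex_lt v u.
  case: u v uv fuv u_ge {uc vc only wv f_inj} => [i|x] [j|y] //= ij [].
  - by rewrite -leqNgt ltn_neqAle => _ ->; rewrite andbT;
      apply: contraNneq ij => /val_inj ->.
  - by move=> xy; rewrite (_ : x = y) ?eqxx in ij *; last exact: val_inj.
rewrite (sign_exponent_fold vc uc (esym fuv) v_lt).
  by rewrite exprS mulN1r subrr mul0r.
by move=> x xc; rewrite -fuv => /(only x xc)[]; [right|left].
Qed.

Lemma perverse_degree_cell_map (d : Order.disp_t) (P : porderType d)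
    (s t : simplex P) (f : simplex_hom s t) (c : {set bvertex s}) x :
  s ord_max = t ord_max -> {in c &, injective (bvertex_map f)} ->
  (perverse_degree_cell c x <= perverse_degree_cell (cell_map f c) x)%O.
Proof.
move=> st f_inj; rewrite /perverse_degree_cell st.
case: ifP => // _; have [xs|] := boolP (x \in strata s); last by rewrite leNye.
rewrite (strata_sub f xs) /= block_map //.
have -> : [exists v in bvertex_map f @: block c x, is_apex v] =
    [exists v in block c x, is_apex v].
  apply/existsP/existsP => [[v /andP[/imsetP[u uc ->]]] | [u /andP[uc ua]]].
    by rewrite is_apex_map => ua; exists u; rewrite uc.
  by exists (bvertex_map f u); rewrite imset_f ?is_apex_map.
case: ifP => // _; rewrite (big_strata_map f) => [|y]; last exact: face_dim_map_new.
rewrite le_eqVlt; apply/orP; left; apply/eqP; congr (_%:Z%:E)%E.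
rewrite big_seq_cond [RHS]big_seq_cond; apply: eq_bigr => y /andP[ys _].
by rewrite face_dim_map_inj.
Qed.

Lemma allowable_map (R : comPzRingType) (d : Order.disp_t) (P : porderType d)
    (p : perversity P) (s t : simplex P) (f : simplex_hom s t) n
    (w : cochain R t n) : s ord_max = t ord_max ->
  allowable p w -> allowable p (cochain_map f w).
Proof.
move=> st w_all x; apply: bigmax_le => [|[c cP]]; first exact: leNye.
rewrite ffunE /= => wc; case/andP: (cP) => cc /eqP cn.
have fcP : is_cell (cell_map f c) && (cell_dim (cell_map f c) == n).
  by apply: contraNT wc => /(coord_out w) ->.
have f_inj : {in c &, injective (bvertex_map f)}.
  by apply: cell_map_inj => //; case/andP: fcP => _ /eqP ->.
apply: le_trans (perverse_degree_cell_map x st f_inj) _.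
apply: le_trans (w_all x).
pose fc : cell t n := exist (fun e => is_true (is_cell e && (cell_dim e == n))) _ fcP.
rewrite -[cell_map f c]/(val fc) in wc *.
by apply: (le_bigmax_cond _ (fun e : cell t n => perverse_degree_cell (val e) x));
   rewrite -coordE.
Qed.

Lemma regular_target (d : Order.disp_t) (P : porderType d) (s t : simplex P)
  (f : simplex_hom s t) : regular s -> regular t.
Proof. by move=> s_reg; rewrite /regular -(regular_hom f s_reg). Qed.

(* The restriction of the presheaf, which is 0 on non-regular simplices. *)
Definition Ntilde_map (R : comPzRingType) (d : Order.disp_t) (P : porderType d)
    (s t : simplex P) (f : simplex_hom s t) n (w : cochain R t n) :
    cochain R s n :=
  if `[< regular s >] then cochain_map f w else 0.

Definition cocycle (R : comPzRingType) (d : Order.disp_t) (P : porderType d)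
    (p : perversity P) (n : nat) (s : simplex P) : Type :=
  {w : cochain R s n | Ntilde p w /\ coboundary w = 0}.

Lemma coboundary0 (R : comPzRingType) (d : Order.disp_t) (P : porderType d)
    (s : simplex P) n : coboundary (0 : cochain R s n) = 0.
Proof.
by apply/ffunP => c; rewrite !ffunE big1 // => v _; rewrite coord0 mulr0.
Qed.

Lemma allowable0 (R : comPzRingType) (d : Order.disp_t) (P : porderType d)
    (p : perversity P) (s : simplex P) n : allowable p (0 : cochain R s n).
Proof.
by move=> x; apply: bigmax_le => [|c]; rewrite ?leNye // ffunE eqxx.
Qed.

Lemma cocycle0_subproof (R : comPzRingType) (d : Order.disp_t)
    (P : porderType d) (p : perversity P) n (s : simplex P) :
  Ntilde p (0 : cochain R s n) /\ coboundary (0 : cochain R s n) = 0.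
Proof.
split; last exact: coboundary0.
by split=> // _; rewrite coboundary0; split; apply: allowable0.
Qed.

Lemma cocycle_map_subproof (R : comPzRingType) (d : Order.disp_t)
    (P : porderType d) (p : perversity P) n (s t : simplex P)
    (f : simplex_hom s t) (w : cochain R t n) :
  Ntilde p w /\ coboundary w = 0 ->
  Ntilde p (Ntilde_map f w) /\ coboundary (Ntilde_map f w) = 0.
Proof.
case=> -[w_all _] w0; rewrite /Ntilde_map; case: asboolP => s_reg; last first.
  exact: cocycle0_subproof.
have st := regular_hom f s_reg.
have [wp wp'] := w_all (regular_target f s_reg).
rewrite -cochain_map_coboundary // w0 cochain_map0; split=> //; split=> // _.
rewrite -cochain_map_coboundary // w0 cochain_map0.
by split; [apply: allowable_map | apply: allowable0].
Qed.

Program Definition EM (R : comPzRingType) (d : Order.disp_t) (P : porderType d)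
    (p : perversity P) (n : nat) : presheaf (DeltaP P) :=
  @Presheaf (DeltaP P) (@cocycle R d P p n)
    (fun s t f w => exist _ (Ntilde_map f (sval w))
                          (cocycle_map_subproof f (svalP w))) _ _.
Next Obligation.
move=> R d P p n s [w [[w_all wN] w0]]; apply: eq_exist => /=; rewrite /Ntilde_map.
by case: asboolP => s_reg; [apply: cochain_map_id | rewrite wN].
Qed.
Next Obligation.
move=> R d P p n s t u g f [w wP]; apply: eq_exist => /=; rewrite /Ntilde_map.
case: asboolP => s_reg //; have t_reg := regular_target f s_reg.
rewrite (asboolT t_reg); apply: cochain_map_comp.
exact: regular_hom.
Qed.

Program Definition EM_point (R : comPzRingType) (d : Order.disp_t)
    (P : porderType d) (p : perversity P) (n : nat) :
    psmap (final (DeltaP P)) (EM R p n) :=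
  @PsMap _ (final (DeltaP P)) (EM R p n)
    (fun s _ => exist _ 0 (cocycle0_subproof R p n s)) _.
Next Obligation.
move=> R d P p n s t f u; apply: eq_exist => /=; rewrite /Ntilde_map.
by case: ifP => // _; rewrite cochain_map0.
Qed.

Definition EM_pointed (R : comPzRingType) (d : Order.disp_t) (P : porderType d)
    (p : perversity P) (n : nat) : pointed (DeltaP P) :=
  Pointed (EM_point R p n).

Program Definition EM_plus_point (R : comPzRingType) (d : Order.disp_t)
    (P : porderType d) (p : perversity P) (n : nat) :
    psmap (final (DeltaPreg P)) (restrict (DeltaPreg_incl P) (EM R p n)) :=
  @PsMap _ (final (DeltaPreg P)) (restrict (DeltaPreg_incl P) (EM R p n))
    (fun s => EM_point R p n (sval s)) _.
Next Obligation. by move=> *; apply: (psnat (EM_point _ _ _)). Qed.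

Definition EM_plus_pointed (R : comPzRingType) (d : Order.disp_t)
    (P : porderType d) (p : perversity P) (n : nat) : pointed (DeltaPreg P) :=
  Pointed (EM_plus_point R p n).

(* Main.v *)
(* All mapping spaces Hom(Z, K(n)) are simplicial abelian groups, hence Kan.

   For the loop spaces, suspension sends a cocycle w and phi : sigma -> Delta[1]
   to the coboundary of the cochain "phi(first vertex) w".  The first vertex of
   a cell which is not an apex only depends on the blocks up to the first one
   without apex, which is why this cut-off preserves allowability.  In the
   other direction, a loop is integrated over Delta[1] with the prism
   decomposition of sigma x Delta[1], carried out in each block of the blow-up
   with the apexes kept fixed; since a prism over a cell has at least the
   perverse degree of the cell, integration preserves allowability as well.
   Integration inverts suspension on the nose, and a loop differs from the
   suspension of its integral by the coboundary of a relative cochain, which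
   gives the homotopy in the other direction. *)

From mathcomp Require Import all_boot all_order all_algebra.
From mathcomp Require Import boolp constructive_ereal.
From mathcomp Require Import zify.
From Stdlib Require Import Relation_Operators.
Require Import Defs.

Set Implicit Arguments.
Unset Strict Implicit.
Unset Printing Implicit Defensive.

Import Order.TTheory GRing.Theory.
Local Open Scope ring_scope.

#[local] Obligation Tactic := idtac.

(** Both statements are instances of one about a functor [I] to Δ[P], the identity or the inclusion
    of the regular simplices. A path is then a family of cocycles on the simplices of σ × Δ[1] over
    P. The obstacle is that σ × Δ[1] is not a simplex and so has no blown-up cells of its own: its
    prisms must be cells of blown-up simplices. All of them are found in a single simplex [dbl s],
    in which each vertex of [s] occurs twice; the prism that changes copies at the vertex [j] is one
    cell of it, evaluated along the map to Δ[1] that jumps at [j]. This map varies with [j], so two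
    prisms can be compared on a common face only because a value depends on the map at the vertices
    of that face alone, which is [cyl_local]. Interpolation along Δ[1] is always done by cutting
    off: the cut-off of a cochain runs from 0 to the cochain itself, and its coboundary is a path of
    cocycles. This yields both the suspension and the final homotopy. As the suspension has a strict
    left inverse, one homotopy on the loop space is enough for the weak equivalence. *)

(** * Kan complexes and homotopy equivalences *)

(* The face [j] is added to a partial filling [y] by [y - c^* y + f c], where
   [c] collapses [j] onto its neighbour towards [r]; the faces are added from
   the farthest to the nearest to [r], so that [c] does not disturb those
   already filled. *)
Definition toward (r j : nat) : nat := if (j < r)%N then j.+1 else j.-1.

Lemma collapse_mono n (r j : 'I_n.+1) : j != r ->
  monotoneb [ffun i : 'I_n.+1 => if i == j then inord (toward r j) else i].
Proof.
move=> jr; have rn := ltn_ord r; have jn := ltn_ord j.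
have {}jr : (j != r :> nat) by [].
apply/forallP => a; apply/forallP => b; apply/implyP => ab.
have an := ltn_ord a; have bn := ltn_ord b.
rewrite !ffunE leEord; have [aj|aj] := eqVneq a j; have [bj|bj] := eqVneq b j => //.
- rewrite inordK /toward; last by case: ifP; lia.
  by case: ifP => ?; move: bj; rewrite -val_eqE /=; subst; lia.
- rewrite inordK /toward; last by case: ifP; lia.
  by case: ifP => ?; move: aj; rewrite -val_eqE /=; subst; lia.
Qed.

Definition collapse n (r j : 'I_n.+1) (jr : j != r) : nerve 'I_n.+1 n :=
  Chain (collapse_mono jr).

(** Moore's theorem on simplicial groups, phrased with the operation x - y + z that its proof
    uses. *)
Lemma malcev_kan (X : sset) (m : forall k, X k -> X k -> X k -> X k) :
  (forall k l (f : hom k l) x y z,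
    act f (m l x y z) = m k (act f x) (act f y) (act f z)) ->
  (forall k x y, m k x y y = x) -> (forall k x y, m k x x y = y) -> kan X.
Proof.
move=> m_nat mr ml n r f.
have hornE k (a b : horn r k) : sval a = sval b -> a = b.
  by case: a b => a aP [b bP] /= ab; apply: eq_exist.
pose fills (S : pred 'I_n.+2) y := forall k (a : horn r k),
  (exists2 j, S j & forall i, sval a i != j) -> act (sval a) y = f k a.
(* The neighbour onto which [c] collapses [j] must not be in [S] yet: then a simplex that misses
   some [i] in [S] still misses it after composition with [c]. *)
have step S y (j : 'I_n.+2) : j != r -> ~~ S (inord (toward r j)) -> fills S y ->
    exists y', fills (predU1 j S) y'.
  move=> jr SN yS; pose c : hom (n.+1 : Delta) (n.+1 : Delta) := collapse jr.
  have jN : inord (toward r j) != j.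
    rewrite -val_eqE /= inordK /toward.
      by case: ifP => ? /=; move: (jr) (ltn_ord j); rewrite -val_eqE /=; lia.
    by case: ifP => ? /=; move: (jr) (ltn_ord j) (ltn_ord r); rewrite -val_eqE /=; lia.
  have cj i : collapse jr i != j by rewrite ffunE; have [_|] := eqVneq i j.
  pose ch : horn r n.+1 := exist _ (collapse jr : stdsimplex n.+1 n.+1)
    (ex_intro2 _ _ j jr cj).
  exists (m _ y (act c y) (f _ ch)) => k a [i iS ai].
  pose a' : hom (k : Delta) (n.+1 : Delta) := sval a.
  have fch : act a' (f _ ch) = f _ (act a' ch) by rewrite psnat.
  rewrite -[sval a]/a' m_nat fch -act_comp.
  have [ai'|] := boolP [forall i, sval a i != j].
    have ca : comp c a' = a'.
      by apply: nerveP => b; rewrite !ffunE; move/forallP/(_ b)/negPf: ai' => ->.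
    by rewrite ca ml; congr (f k _); apply: hornE.
  move/forallPn => [b /negPn/eqP ab].
  case/predU1P: iS => [ij|iS]; first by case/eqP: (ai b); rewrite ab ij.
  rewrite (yS _ a); last by exists i.
  have -> : act (comp c a') y = f _ (act a' ch).
    apply: (yS _ (act a' ch)); exists i => // l; rewrite !ffunE.
    have [_|_] := eqVneq (sval a l) j; last exact: ai.
    by apply: contraNneq SN => ->.
  exact: mr.
(* The induction needs some simplex to begin with; the value of [f] on the constant simplex at [r]
   is at hand, since that simplex misses every other vertex. *)
have jr0 : (if r == ord0 then ord_max else ord0) != r.
  by have [->|] := eqVneq r ord0; rewrite // eq_sym.
have rP : exists2 j, j != r & forall i, (ncst n.+1 r : stdsimplex n.+1 n.+1) i != j.
  by exists (if r == ord0 then ord_max else ord0) => // i; rewrite ffunE eq_sym.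
pose start : horn r n.+1 := exist _ _ rP.
have ext (S S' : pred 'I_n.+2) y : (forall j, S' j -> S j) -> fills S y -> fills S' y.
  by move=> SS yS k a [j /SS jS aj]; apply: yS; exists j.
have left_fill l : (l <= r)%N -> exists y, fills (fun j => (j < l)%N) y.
  elim: l => [_|l IH lr]; first by exists (f _ start) => k a [].
  have ln : (l < n.+2)%N by apply: ltn_trans (ltn_ord r).
  have [y yS] := IH (ltnW lr); case: (step _ y (Ordinal ln) _ _ yS).
  - by rewrite -val_eqE /=; lia.
  - by rewrite /toward /= lr inordK -?leqNgt //; move: (ltn_ord r); lia.
  move=> y' y'S; exists y'; apply: ext y'S => j /=.
  by rewrite -val_eqE /=; lia.
have right_fill l : (l <= n.+1 - r)%N ->
    exists y, fills (fun j => (j < r)%N || (n.+1 - l < j)%N) y.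
  elim: l => [_|l IH lr].
    have [y yS] := left_fill r (leqnn r); exists y; apply: ext yS => j.
    by have := ltn_ord j; lia.
  have ln : (n.+1 - l < n.+2)%N by lia.
  have [y yS] := IH (ltnW lr); case: (step _ y (Ordinal ln) _ _ yS).
  - by rewrite -val_eqE /=; lia.
  - by rewrite /toward /= inordK; case: ifP; lia.
  move=> y' y'S; exists y'; apply: ext y'S => j /=.
  by rewrite -val_eqE /=; lia.
have [y yS] := right_fill _ (leqnn _).
have y_nat k l (g : hom k l) (a : stdsimplex n.+1 l) :
    act (act g a : hom (k : Delta) (n.+1 : Delta)) y =
    act g (act (a : hom (l : Delta) (n.+1 : Delta)) y).
  exact: act_comp.
exists (PsMap y_nat); apply: psmap_eq => k a /=; apply: yS.
case: (svalP a) => j jr aj; exists j => //.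
by move: jr; rewrite -val_eqE /=; lia.
Qed.

Lemma connected_eq (X : sset) (x y : X 0%N) : connected x y -> connected x = connected y.
Proof.
move=> xy; apply: funext => z; apply: propext; split=> h.
  exact: rst_trans (rst_sym _ _ _ _ xy) h.
exact: rst_trans xy h.
Qed.

Definition path_component (X : sset) (x : X 0%N) : pi0 X :=
  exist _ (connected x) (ex_intro _ x erefl).

Lemma pi0_map_component (X Y : sset) (f : psmap X Y) x :
  pi0_map f (path_component x) = path_component (f 0%N x).
Proof.
apply: eq_exist => /=; apply: funext => y; apply: propext.
split=> [[x' xx' x'y]|xy]; last by exists x => //; apply: rst_refl.
exact: rst_trans (connected_map f xx') x'y.
Qed.

Lemma path_component_onto (X : sset) (c : pi0 X) : exists x, c = path_component x.
Proof. by case: c => c [x cx]; exists x; apply: eq_exist. Qed.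

(** Composed with a vertex [x] of [HomDelta D Z B], the homotopy [h] becomes an edge from [f g x] to
    [x]; so [g] induces the inverse on components for every [Z]. *)
Lemma deformation_equivalence (C : category) (D : functor C Delta)
    (A B : presheaf C) (f : psmap A B) (g : psmap B A)
    (h : psmap (tensor D B (stdsimplex 1)) B) :
  (forall a x, g a (f a x) = x) ->
  (forall a x, h a (x, ncst (D a) ord0) = f a (g a x)) ->
  (forall a x, h a (x, ncst (D a) ord_max) = x) ->
  weak_s_equivalence D f.
Proof.
move=> gf h0 h1 Z; exists (pi0_map (HomDelta_map D Z g)) => c.
  have [x ->] := path_component_onto c; rewrite !pi0_map_component.
  by congr path_component; apply: psmap_eq => a y /=; rewrite gf.
have [x ->] := path_component_onto c; rewrite !pi0_map_component.
apply: eq_exist; apply: connected_eq; apply: rst_step.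
(* A vertex of [HomDelta] is a map on Z ⊗ Δ[0]; [pt] makes it constant along Δ[1]. *)
pose pt : psmap (stdsimplex 1) (stdsimplex 0) := @yoneda_map Delta 1%N 0%N (ncst 1 ord0).
pose q : psmap (tensor D Z (stdsimplex 1)) (tensor D B (stdsimplex 1)) :=
  pspair (pscomp x (tensor_map D (psid Z) pt))
    (@PsMap _ (tensor D Z (stdsimplex 1)) (restrict D (stdsimplex 1))
       (fun a y => y.2) (fun _ _ _ _ => erefl)).
exists (pscomp h q).
have ptE k (y y' : stdsimplex 0 k) : y = y'.
  by apply: nerveP => i; rewrite !ord1.
have cstE (e : 'I_2) k (y : stdsimplex 0 k) :
    ncomp (ncst 0 e) y = ncst k e by apply: nerveP => i; rewrite !ffunE.
split; apply: psmap_eq => a [y z] /=; rewrite cstE ?h0 ?h1.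
  by congr (f _ (g _ (x _ (_, _)))); apply: ptE.
by congr (x _ (_, _)); apply: ptE.
Qed.

(** * Blown-up cochains *)

Section Cochains.
Variables (R : comPzRingType) (d : Order.disp_t) (P : porderType d).
Implicit Types (s t : simplex P) (p : perversity P).

Lemma coordB s n (w w' : cochain R s n) c :
  coord (w - w') c = coord w c - coord w' c.
Proof. by rewrite /coord; case: insub => [c'|] /=; rewrite ?ffunE // subr0. Qed.

Lemma coordD s n (w w' : cochain R s n) c :
  coord (w + w') c = coord w c + coord w' c.
Proof. by rewrite /coord; case: insub => [c'|] /=; rewrite ?ffunE // addr0. Qed.

Lemma cochain_coordP s n (w w' : cochain R s n) :
  (forall c, is_cell c -> cell_dim c = n -> coord w c = coord w' c) -> w = w'.
Proof.
move=> ww'; apply/ffunP => c; rewrite -!coordE; case/andP: (valP c) => cc /eqP.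
exact: ww'.
Qed.

Lemma coord_neq0 s n (w : cochain R s n) c :
  coord w c != 0 -> is_cell c /\ cell_dim c = n.
Proof.
move=> wc; have /andP[cc /eqP cn] : is_cell c && (cell_dim c == n).
  by apply: contraNT wc => /(coord_out w) ->.
by [].
Qed.

Lemma coboundaryB s n (w w' : cochain R s n) :
  coboundary (w - w') = coboundary w - coboundary w'.
Proof.
apply/ffunP => c; rewrite !ffunE -sumrB; apply: eq_bigr => v _.
by rewrite coordB mulrBr.
Qed.

Lemma coboundaryD s n (w w' : cochain R s n) :
  coboundary (w + w') = coboundary w + coboundary w'.
Proof.
apply/ffunP => c; rewrite !ffunE -big_split; apply: eq_bigr => v _.
by rewrite coordD mulrDr.
Qed.

Lemma cochain_mapB s t (f : simplex_hom s t) n (w w' : cochain R t n) :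
  cochain_map f (w - w') = cochain_map f w - cochain_map f w'.
Proof. by apply/ffunP => c; rewrite !ffunE coordB. Qed.

Lemma cochain_mapD s t (f : simplex_hom s t) n (w w' : cochain R t n) :
  cochain_map f (w + w') = cochain_map f w + cochain_map f w'.
Proof. by apply/ffunP => c; rewrite !ffunE coordD. Qed.

Lemma Ntilde_mapB s t (f : simplex_hom s t) n (w w' : cochain R t n) :
  Ntilde_map f (w - w') = Ntilde_map f w - Ntilde_map f w'.
Proof. by rewrite /Ntilde_map; case: ifP; rewrite ?cochain_mapB ?subr0. Qed.

Lemma Ntilde_mapD s t (f : simplex_hom s t) n (w w' : cochain R t n) :
  Ntilde_map f (w + w') = Ntilde_map f w + Ntilde_map f w'.
Proof. by rewrite /Ntilde_map; case: ifP; rewrite ?cochain_mapD ?addr0. Qed.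

Lemma allowableP p s n (w : cochain R s n) :
  allowable p w <->
  forall c x, coord w c != 0 -> (perverse_degree_cell c x <= p x)%O.
Proof.
split=> [w_all c x wc | w_all x].
  apply: le_trans (w_all x); have [cc cn] := coord_neq0 wc.
  have cP : is_cell c && (cell_dim c == n) by rewrite cc cn eqxx.
  pose c' : cell s n := exist (fun e => is_true (is_cell e && (cell_dim e == n))) _ cP.
  rewrite -[c]/(val c') coordE in wc *.
  exact: (le_bigmax_cond _ (fun e : cell s n => perverse_degree_cell (val e) x)).
apply: bigmax_le => [|c wc]; first exact: leNye.
by apply: w_all; rewrite coordE.
Qed.

Lemma allowableB p s n (w w' : cochain R s n) :
  allowable p w -> allowable p w' -> allowable p (w - w').
Proof.
move=> /allowableP w_all /allowableP w'_all; apply/allowableP => c x.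
rewrite coordB; have [w0|w0] := eqVneq (coord w c) 0; last by move=> _; apply: w_all.
by rewrite w0 sub0r oppr_eq0; apply: w'_all.
Qed.

Lemma allowableD p s n (w w' : cochain R s n) :
  allowable p w -> allowable p w' -> allowable p (w + w').
Proof.
move=> /allowableP w_all /allowableP w'_all; apply/allowableP => c x.
rewrite coordD; have [w0|w0] := eqVneq (coord w c) 0; last by move=> _; apply: w_all.
by rewrite w0 add0r; apply: w'_all.
Qed.

Lemma NtildeB p s n (w w' : cochain R s n) :
  Ntilde p w -> Ntilde p w' -> Ntilde p (w - w').
Proof.
move=> [w_all w0] [w'_all w'0]; split=> s_reg; last by rewrite w0 ?w'0 ?subrr.
have [[wa dwa] [wa' dwa']] := (w_all s_reg, w'_all s_reg).
by rewrite coboundaryB; split; apply: allowableB.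
Qed.

Lemma NtildeD p s n (w w' : cochain R s n) :
  Ntilde p w -> Ntilde p w' -> Ntilde p (w + w').
Proof.
move=> [w_all w0] [w'_all w'0]; split=> s_reg; last by rewrite w0 ?w'0 ?addr0.
have [[wa dwa] [wa' dwa']] := (w_all s_reg, w'_all s_reg).
by rewrite coboundaryD; split; apply: allowableD.
Qed.

Lemma Ntilde_map_Ntilde p s t (f : simplex_hom s t) n (w : cochain R t n) :
  Ntilde p w -> Ntilde p (Ntilde_map f w).
Proof.
move=> [w_all _]; rewrite /Ntilde_map; case: asboolP => s_reg; last first.
  by have [] := cocycle0_subproof R p n s.
have st := regular_hom f s_reg; have [wa dwa] := w_all (regular_target f s_reg).
split=> // _; rewrite -cochain_map_coboundary //.
by split; apply: allowable_map.
Qed.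

Lemma Ntilde_map_coboundary s t (f : simplex_hom s t) n (w : cochain R t n) :
  coboundary (Ntilde_map f w) = Ntilde_map f (coboundary w).
Proof.
rewrite /Ntilde_map; case: asboolP => s_reg; last exact: coboundary0.
by rewrite cochain_map_coboundary //; apply: regular_hom f s_reg.
Qed.

(* [cutoff phi w] is the cup product of [w] with the 0-cochain of Delta[1] of
   values 0, 1, pulled back along [phi] and blown up: its value on a cell is
   the value of [phi] at the first vertex which is not an apex. *)
Definition cutoff s (phi : nerve 'I_2 (sdim s)) n (w : cochain R s n) :
    cochain R s n :=
  [ffun c : cell s n =>
     if [forall i, (inl i \in val c) ==> (phi i != ord0)] then w c else 0].

Lemma coord_cutoff s (phi : nerve 'I_2 (sdim s)) n (w : cochain R s n) c :
  coord (cutoff phi w) c =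
  if [forall i, (inl i \in c) ==> (phi i != ord0)] then coord w c else 0.
Proof.
rewrite /coord; case: insubP => [c' _ <-|_] /=; rewrite ?ffunE //.
by case: ifP.
Qed.

Lemma cutoff_map s t (f : simplex_hom s t) (phi : nerve 'I_2 (sdim t)) n
    (w : cochain R t n) :
  cochain_map f (cutoff phi w) = cutoff (ncomp phi f) (cochain_map f w).
Proof.
apply/ffunP => c; rewrite !ffunE coord_cutoff; congr (if _ then _ else _).
apply/forallP/forallP => [phi1 i|phi1 i]; apply/implyP.
  move=> ic; rewrite ffunE; apply: (implyP (phi1 (f i))).
  by rewrite in_setU; apply/orP; left; apply/imsetP; exists (inl i).
rewrite in_setU => /orP[/imsetP[[j|//] jc [->]]|/imsetP[//]].
by have := phi1 j; rewrite jc ffunE.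
Qed.

Lemma block_base s c x : is_cell c -> x \in strata s ->
  ~~ [exists v in block c x, is_apex v] ->
  exists2 i : 'I_(sdim s).+1, inl i \in c & s i = x.
Proof.
case/andP => /allP c0 _ /c0 /set0Pn[v vc] /existsPn/(_ v).
rewrite vc /=; case: v vc => // i; rewrite inE => /andP[ic /eqP ix] _.
by exists i.
Qed.

(** The block over the last stratum is never coned, so the first vertex that is not an apex, on
    which the cut-off depends, always exists. *)
Lemma cell_base s c : is_cell c ->
  exists2 i : 'I_(sdim s).+1, inl i \in c & s i = s ord_max.
Proof. by move=> cc; apply: block_base (top_in s) _ => //; case/andP: cc. Qed.

Lemma cutoff_cst0 s n (w : cochain R s n) : cutoff (ncst (sdim s) ord0) w = 0.
Proof.
apply/cochain_coordP => c cc _; rewrite coord_cutoff coord0; case: ifP => // /forallP phi1.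
by have [i ic _] := cell_base cc; have := phi1 i; rewrite ic ffunE.
Qed.

Lemma cutoff_cst1 s n (w : cochain R s n) : cutoff (ncst (sdim s) ord_max) w = w.
Proof.
apply/cochain_coordP => c cc _; rewrite coord_cutoff ifT //.
by apply/forallP => i; rewrite ffunE implybT.
Qed.

Lemma cutoff0 s (phi : nerve 'I_2 (sdim s)) n :
  cutoff phi (0 : cochain R s n) = 0.
Proof. by apply/ffunP => c; rewrite !ffunE if_same. Qed.

(** Such a [v] lies in no block after [x], so the dimensions that enter the degree are unchanged. In
    the block of [x] itself at most an apex disappears, which raises the degree from [-oo]. *)
Lemma perverse_degree_cellD1 s (c : {set bvertex s}) v x :
  ~~ (x < stratum v)%O ->
  (perverse_degree_cell c x <= perverse_degree_cell (c :\ v) x)%O.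
Proof.
move=> xv; rewrite /perverse_degree_cell; case: ifP => // _.
case: ifP => [/andP[-> /existsPn no_apex]|_]; last exact: leNye.
rewrite ifT; last first.
  apply/existsPn => u; apply: contra (no_apex u) => /andP[uc ->].
  by move: uc; rewrite !inE => /andP[/andP[_ ->] ->].
rewrite le_eqVlt; apply/orP; left; apply/eqP; congr (_%:Z%:E)%E.
apply: eq_bigr => y xy; rewrite /face_dim; congr predn; apply: eq_card => u.
rewrite !inE; have [->|//] := eqVneq u v.
by case: (stratum v =P y) => [vy|_]; rewrite ?andbF //; rewrite vy xy in xv.
Qed.

(** For the coboundary, take a cell [c] whose degree at [x] violates the bound. There [coboundary w]
    vanishes, and so does [w] on the faces opposite to vertices not above [x]. As the degree is not
    [-oo], [c] has a vertex [i] over [x] that is not an apex; removing a vertex above [x] leaves [i]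
    in place, hence the cut-off factor too. So the coboundary of the cut-off at [c] is this factor
    times that of [w], which is 0. *)
Lemma cutoff_Ntilde p s (phi : nerve 'I_2 (sdim s)) n (w : cochain R s n) :
  Ntilde p w -> Ntilde p (cutoff phi w).
Proof.
move=> [w_all w0]; split=> s_reg; last by rewrite w0 ?cutoff0.
have [/allowableP wa /allowableP dwa] := w_all s_reg.
split; apply/allowableP => c x.
  by rewrite coord_cutoff; case: ifP => [_|_ /eqP//]; apply: wa.
move=> dc; have [cc cn] := coord_neq0 dc; move: dc.
apply: contraNT => degN; rewrite coboundaryE //.
have dw0 : coord (coboundary w) c = 0.
  by apply/eqP; apply: contraNT degN => /dwa.
have w_face v : v \in c -> ~~ (x < stratum v)%O -> coord w (c :\ v) = 0.
  move=> vc xv; apply/eqP; apply: contraNT degN => /(wa _ x).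
  exact: le_trans (perverse_degree_cellD1 _ xv).
have [i ic six] : exists2 i, inl i \in c & s i = x.
  move: degN; rewrite /perverse_degree_cell; case: ifP => [/eqP -> _|_].
    exact: cell_base.
  by case: ifP => [/andP[xs apexN] _|_]; [apply: block_base | rewrite leNye].
rewrite (eq_bigr (fun v => (if [forall i, (inl i \in c) ==> (phi i != ord0)]
    then 1 else 0) * ((-1) ^+ sign_exponent c v * coord w (c :\ v)))).
  by rewrite -mulr_sumr -coboundaryE // dw0 mulr0.
move=> v vc; rewrite coord_cutoff.
have [xv|xv] := boolP (x < stratum v)%O; last by rewrite w_face // if_same !mulr0.
have -> : [forall j, (inl j \in c :\ v) ==> (phi j != ord0)] =
    [forall j, (inl j \in c) ==> (phi j != ord0)].
  apply/forallP/forallP => phi1 j; apply/implyP; last first.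
    by rewrite inE => /andP[_ jc]; move: (phi1 j); rewrite jc.
  move=> jc; have [vj|vj] := eqVneq v (inl j); last first.
    by have := phi1 j; rewrite !inE eq_sym vj jc.
  have := phi1 i; rewrite !inE ic andbT vj.
  have ij : (i < j)%N.
    rewrite ltnNge; apply: contraTN xv => ji; rewrite vj -six /=.
    by apply/negP => /lt_geF; rewrite (chain_le s).
  have -> : (inl i != inl j :> bvertex s) by apply/eqP => -[ijE]; rewrite ijE ltnn in ij.
  have := chain_le phi (ltnW ij); rewrite leEord -!val_eqE /= -!lt0n => le_phi phi_i.
  exact: leq_trans phi_i le_phi.
by case: ifP => _; rewrite ?mul1r ?mulr0 ?mul0r.
Qed.
End Cochains.

(** * Prisms *)

Section Prism.
Variables (d : Order.disp_t) (P : porderType d).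
Implicit Types (s t : simplex P).

(** The order of vertices behind the Koszul signs: lexicographic in the stratum and the position
    inside the block. *)
Definition before s (u v : bvertex s) : bool :=
  (stratum u < stratum v)%O || ((stratum u == stratum v) && vertex_lt u v).

Lemma before_total s (u v : bvertex s) : u != v -> before v u = ~~ before u v.
Proof.
have mono (i j : 'I_(sdim s).+1) : (s i < s j)%O -> (i < j)%N.
  move=> sij; rewrite ltnNge; apply: contraTN sij => ji.
  by apply/negP => /lt_geF; rewrite (chain_le s).
have [i iu] := strataP _ _ (stratum_in u); have [j jv] := strataP _ _ (stratum_in v).
have cmp : (stratum u >=< stratum v)%O.
  rewrite -iu -jv; apply/orP; have [ij|ji] := leqP i j; [left|right].
    exact: chain_le.
  by apply: chain_le; apply: ltnW.
rewrite /before; case: (comparable_ltgtP cmp) => //= suv uv.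
case: u v {i j iu jv cmp} suv uv => [i|x] [j|y] //= suv uv.
  have {}uv : i != j by apply: contraNneq uv => ->.
  by rewrite -leqNgt ltn_neqAle eq_sym uv.
by case/eqP: uv; congr inr; apply: val_inj.
Qed.

(** As the block of [u] does not become empty, its dimension drops by exactly one, in spite of the
    truncated predecessor in [face_dim]. The sign cancellations for prisms and in [coboundaryK] come
    from this formula. *)
Lemma sign_exponentD1 s (c : {set bvertex s}) u v : u \in c ->
  block (c :\ u) (stratum u) != set0 ->
  sign_exponent c v = (sign_exponent (c :\ u) v + before u v)%N.
Proof.
move=> uc u_block; have block_u x : block (c :\ u) x = block c x :\ u.
  by apply/setP => w; rewrite !inE andbA.
have dimE x : face_dim c x = (face_dim (c :\ u) x + (x == stratum u))%N.
  rewrite /face_dim; have [->|xu] := eqVneq x (stratum u).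
    move: u_block; rewrite -card_gt0 block_u => u_block.
    by rewrite (cardsD1 u (block c _)) inE uc eqxx addn1 prednK.
  rewrite addn0; congr predn; rewrite block_u; apply: eq_card => w.
  rewrite !inE; have [->|//] := eqVneq w u.
  by rewrite eq_sym (negPf xu) andbF.
rewrite /sign_exponent (eq_bigr _ (fun x _ => dimE x)) big_split /= -!addnA.
congr addn; rewrite /before; have ltE : (\sum_(x <- strata s | (x < stratum v)%O)
    (x == stratum u) = (stratum u < stratum v)%O)%N.
  rewrite big_mkcond (bigD1_seq (stratum u)) ?undup_uniq ?stratum_in //= eqxx.
  by rewrite big1 ?addn0 => [|x /negPf ->]; [case: ifP | rewrite if_same].
have -> : [set w in block c (stratum v) | vertex_lt w v] =
    if (stratum u == stratum v) && vertex_lt u v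
    then u |: [set w in block (c :\ u) (stratum v) | vertex_lt w v]
    else [set w in block (c :\ u) (stratum v) | vertex_lt w v].
  apply/setP => w; case: ifP => uv; rewrite !inE; have [->|//] := eqVneq w u;
    rewrite uc /=; exact: uv.
rewrite ltE addnC; case: ifP => [/andP[/eqP uv _]|_].
  by rewrite cardsU1 !inE eqxx /= uv ltxx addn0 addnC.
by rewrite orbF.
Qed.

Lemma halves_mono m :
  monotoneb [ffun k : 'I_m.*2.+2 => inord k./2 : 'I_m.+1].
Proof.
apply/forallP => i; apply/forallP => j; apply/implyP => ij.
have := ltn_ord i; have := ltn_ord j; move: ij.
by rewrite !ffunE leEord /= => ij jm im; rewrite !inordK; lia.
Qed.

Definition halves m : nerve 'I_m.+1 m.*2.+1 := Chain (halves_mono m).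

(** Each simplex of the usual triangulation of s × Δ[1] is a face of [dbl s] together with a step
    map to Δ[1]. *)
Definition dbl s : simplex P := Simplex (ncomp s (halves (sdim s))).

Definition dbl_proj s : simplex_hom (dbl s) s :=
  @SimplexHom _ _ (dbl s) s (halves (sdim s)) erefl.

Lemma step_mono m a :
  monotoneb [ffun k : 'I_m.+1 => if (a <= k)%N then ord_max else ord0 : 'I_2].
Proof.
apply/forallP => i; apply/forallP => j; apply/implyP => ij.
rewrite !ffunE leEord; have [ai|_] := leqP a i; first by rewrite (leq_trans ai ij).
exact: leq0n.
Qed.

Definition step m a : nerve 'I_2 m := Chain (step_mono m a).

Lemma lower_subproof m (j : 'I_m.+1) : (j.*2 < m.*2.+2)%N.
Proof. by have := ltn_ord j; lia. Qed.
Definition lower m (j : 'I_m.+1) : 'I_m.*2.+2 := Ordinal (lower_subproof j).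
Lemma upper_subproof m (j : 'I_m.+1) : (j.*2.+1 < m.*2.+2)%N.
Proof. by have := ltn_ord j; lia. Qed.
Definition upper m (j : 'I_m.+1) : 'I_m.*2.+2 := Ordinal (upper_subproof j).

Lemma halves_val m k : halves m k = k./2 :> nat.
Proof. by rewrite ffunE inordK //; have := ltn_ord k; lia. Qed.

Lemma halves_lower m j : halves m (lower j) = j.
Proof. by apply: val_inj; rewrite /= halves_val /= doubleK. Qed.

Lemma halves_upper m j : halves m (upper j) = j.
Proof. by apply: val_inj; rewrite /= halves_val /= uphalf_double. Qed.

(* The vertices [2 i] and [2 i + 1] of [dbl s] are two copies of the vertex [i]
   of [s].  [split_cell a c] takes the lower copy of the vertices before [a]
   and the upper copy of the others, [prism_cell j c] takes both copies of
   [j]; only the restriction of [step] to these copies matters. *)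
Definition split_cell s (a : nat) (c : {set bvertex s}) : {set bvertex (dbl s)} :=
  [set v | (bvertex_map (dbl_proj s) v \in c) &&
           (if v is inl k then odd k == (a <= k./2)%N else true)].

Definition prism_cell s (j : 'I_(sdim s).+1) (c : {set bvertex s}) :
    {set bvertex (dbl s)} := inl (lower j) |: split_cell j c.

Lemma bvertex_proj_inj s a (c : {set bvertex s}) :
  {in split_cell a c &, injective (bvertex_map (dbl_proj s))}.
Proof.
move=> [i|x] [j|y]; rewrite !inE //= => /andP[_ ic] /andP[_ jc] [].
  move=> /(congr1 val); rewrite /= !halves_val => ij; congr inl; apply: val_inj.
  by move: ic jc => /eqP ic /eqP jc /=; rewrite -(odd_double_half i) -(odd_double_half j) ic jc ij.
by move=> xy; congr inr; apply: val_inj.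
Qed.

Lemma dbl_strata s x : (x \in strata (dbl s)) = (x \in strata s).
Proof.
apply/idP/idP; first exact: (strata_sub (dbl_proj s)).
by case/strataP => i <-; apply/strataP; exists (lower i); rewrite ffunE halves_lower.
Qed.

Lemma imset_split_cell s a (c : {set bvertex s}) :
  bvertex_map (dbl_proj s) @: split_cell a c = c.
Proof.
apply/setP => v; apply/imsetP/idP => [[u]|vc]; first by rewrite inE => /andP[uc _] ->.
case: v vc => [i|x] vc.
  have [ai|ia] := leqP a i.
    exists (inl (upper i)); last by rewrite /= halves_upper.
    by rewrite inE /= halves_upper vc; lia.
  exists (inl (lower i)); last by rewrite /= halves_lower.
  by rewrite inE /= halves_lower vc; lia.
have xs : ssval x \in strata (dbl s) by rewrite dbl_strata ssvalP.
have xE : inr x = bvertex_map (dbl_proj s) (inr (SeqSub xs)).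
  by congr inr; apply: val_inj.
by exists (inr (SeqSub xs)); rewrite // inE -xE vc.
Qed.

Lemma cell_map_proj s (c : {set bvertex (dbl s)}) :
  cell_map (dbl_proj s) c = bvertex_map (dbl_proj s) @: c.
Proof.
apply/setP => v; rewrite in_setU; apply/orb_idr => /imsetP[x].
by rewrite inE dbl_strata ssvalP.
Qed.

Lemma dbl_top s : dbl s ord_max = s ord_max.
Proof.
rewrite ffunE; congr (s _); apply: val_inj; rewrite /= halves_val /=; lia.
Qed.

Lemma is_cell_split s a (c : {set bvertex s}) :
  is_cell (split_cell a c) = is_cell c.
Proof. by rewrite -(is_cell_map (dbl_proj s)) ?dbl_top // cell_map_proj imset_split_cell. Qed.

Lemma cell_dim_split s a (c : {set bvertex s}) :
  cell_dim (split_cell a c) = cell_dim c.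
Proof.
by rewrite -(cell_dim_map_eq (@bvertex_proj_inj s a c)) cell_map_proj imset_split_cell.
Qed.

Lemma imset_prism_cell s j (c : {set bvertex s}) : inl j \in c ->
  bvertex_map (dbl_proj s) @: prism_cell j c = c.
Proof.
move=> jc; rewrite imsetU1 imset_split_cell /= halves_lower.
by apply/setUidPr; rewrite sub1set.
Qed.

Lemma is_cell_prism s j (c : {set bvertex s}) : inl j \in c ->
  is_cell (prism_cell j c) = is_cell c.
Proof.
by move=> jc; rewrite -(is_cell_map (dbl_proj s)) ?dbl_top // cell_map_proj imset_prism_cell.
Qed.

Lemma prism_cellD_lower s j (c : {set bvertex s}) :
  prism_cell j c :\ inl (lower j) = split_cell j c.
Proof.
by apply: setU1K; rewrite inE /= doubleK leqnn odd_double andbF.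
Qed.

Lemma cell_dim_prism s j (c : {set bvertex s}) : is_cell c ->
  cell_dim (prism_cell j c) = (cell_dim c).+1.
Proof.
move=> cc; rewrite -[in RHS](cell_dim_split j c) -prism_cellD_lower face_dimD1 ?setU11 //.
by rewrite prism_cellD_lower is_cell_split.
Qed.

(** With [prism_cellD_lower] this shows that consecutive prisms share a face: the faces opposite to
    the two copies of [j] are the split cells at [j] and [j.+1], which makes the sum in
    [coboundary_prism] telescope. *)
Lemma prism_cellD_upper s j (c : {set bvertex s}) : inl j \in c ->
  prism_cell j c :\ inl (upper j) = split_cell j.+1 c.
Proof.
move=> jc; apply/setP => -[k|x]; rewrite !inE //=.
rewrite -![inl _ == _]/(_ == _ :> 'I__) -!val_eqE /=.
have [kj|kj] := eqVneq k (lower j); first by rewrite kj /= halves_lower jc; lia.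
have [ku|ku] := eqVneq k (upper j); first by rewrite ku /= halves_upper jc; lia.
move: kj ku; rewrite -!val_eqE /=; set b := inl _ \in c; case: b => //=; lia.
Qed.

Lemma split_cellS s (j : 'I_(sdim s).+1) (c : {set bvertex s}) : inl j \notin c ->
  split_cell j.+1 c = split_cell j c.
Proof.
move=> jc; apply/setP => -[k|x]; rewrite !inE //=.
have [kj|kj] := eqVneq (halves _ k) j; first by rewrite kj (negPf jc).
congr (_ && _); move: kj; rewrite -val_eqE /= halves_val; lia.
Qed.

Lemma prism_cellD s (j : 'I_(sdim s).+1) (c : {set bvertex s}) v : v \in split_cell j c ->
  bvertex_map (dbl_proj s) v != inl j ->
  prism_cell j c :\ v = prism_cell j (c :\ bvertex_map (dbl_proj s) v).
Proof.
move=> vc vj; apply/setP => u; rewrite !inE.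
have [->|uv] := eqVneq u v; rewrite ?eqxx ?andbF /=.
  by case: eqP => // uE; rewrite uE /= halves_lower eqxx in vj.
case: (u =P inl (lower j)) => //= uj.
have [puv|//] := eqVneq (bvertex_map (dbl_proj s) u) (bvertex_map (dbl_proj s) v).
apply/negP => uc; case/eqP: uv.
have us : u \in split_cell j c by rewrite in_set; exact: uc.
exact: bvertex_proj_inj us vc puv.
Qed.

Lemma lower_in_prism s (j : 'I_(sdim s).+1) (c : {set bvertex s}) :
  inl (lower j) \in prism_cell j c.
Proof. exact: setU11. Qed.

Lemma upper_in_split s (j : 'I_(sdim s).+1) (c : {set bvertex s}) :
  inl j \in c -> inl (upper j) \in split_cell j c.
Proof. by move=> jc; rewrite in_set /= halves_upper jc /=; lia. Qed.

Lemma lower_in_split s (j : 'I_(sdim s).+1) (c : {set bvertex s}) :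
  inl j \in c -> inl (lower j) \in split_cell j.+1 c.
Proof. by move=> jc; rewrite in_set /= halves_lower jc /=; lia. Qed.

Lemma upper_in_prism s (j : 'I_(sdim s).+1) (c : {set bvertex s}) :
  inl j \in c -> inl (upper j) \in prism_cell j c.
Proof. by move=> jc; rewrite setU1r // upper_in_split. Qed.

Lemma sign_exponent_split s a (c : {set bvertex s}) v : v \in split_cell a c ->
  sign_exponent (split_cell a c) v = sign_exponent c (bvertex_map (dbl_proj s) v).
Proof.
move=> vc; rewrite -(sign_exponent_map (@bvertex_proj_inj s a c) vc).
by rewrite cell_map_proj imset_split_cell.
Qed.

Lemma stratum_lower s (j : 'I_(sdim s).+1) :
  stratum (inl (lower j) : bvertex (dbl s)) = s j.
Proof. by rewrite /= ffunE halves_lower. Qed.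

Lemma stratum_upper s (j : 'I_(sdim s).+1) :
  stratum (inl (upper j) : bvertex (dbl s)) = s j.
Proof. by rewrite /= ffunE halves_upper. Qed.

Lemma sign_exponent_prism_lower s (j : 'I_(sdim s).+1) (c : {set bvertex s}) :
  inl j \in c ->
  sign_exponent (prism_cell j c) (inl (lower j)) = sign_exponent c (inl j).
Proof.
move=> jc; rewrite (sign_exponentD1 _ (upper_in_prism jc)) prism_cellD_upper //.
  rewrite sign_exponent_split ?lower_in_split //= halves_lower.
  rewrite /before stratum_lower stratum_upper ltxx eqxx /=.
  by rewrite ltnNge leqnSn addn0.
apply/set0Pn; exists (inl (lower j)).
by rewrite inE lower_in_split // stratum_lower stratum_upper /=.
Qed.

Lemma lower_block s (j : 'I_(sdim s).+1) (c : {set bvertex s}) : inl j \in c ->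
  block (prism_cell j c :\ inl (lower j)) (stratum (inl (lower j) : bvertex (dbl s))) != set0.
Proof.
move=> jc; rewrite prism_cellD_lower; apply/set0Pn; exists (inl (upper j)).
by rewrite inE upper_in_split // stratum_lower stratum_upper /=.
Qed.

Lemma sign_exponent_prism_upper s (j : 'I_(sdim s).+1) (c : {set bvertex s}) :
  inl j \in c ->
  sign_exponent (prism_cell j c) (inl (upper j)) = (sign_exponent c (inl j)).+1.
Proof.
move=> jc; rewrite (sign_exponentD1 _ (lower_in_prism j c)) ?lower_block //.
rewrite prism_cellD_lower sign_exponent_split ?upper_in_split //= halves_upper.
rewrite /before stratum_lower stratum_upper ltxx eqxx /=.
by rewrite leqnn addn1.
Qed.

Lemma sign_exponent_prism s (j : 'I_(sdim s).+1) (c : {set bvertex s}) v :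
  inl j \in c -> v \in split_cell j c -> bvertex_map (dbl_proj s) v != inl j ->
  sign_exponent (prism_cell j c) v =
  (sign_exponent c (bvertex_map (dbl_proj s) v) +
   before (inl j) (bvertex_map (dbl_proj s) v))%N.
Proof.
move=> jc vc vj; rewrite (sign_exponentD1 _ (lower_in_prism j c)) ?lower_block //.
rewrite prism_cellD_lower sign_exponent_split //; congr (_ + nat_of_bool _)%N.
rewrite /before stratum_map stratum_lower /=; congr (_ || (_ && _)).
case: v vj {vc} => //= k kj; rewrite halves_val.
have {}kj : halves _ k != j by apply: contraNneq kj => ->.
by move: kj; rewrite -val_eqE /= halves_val; lia.
Qed.

(** The left exponent exceeds the right one by [before] taken in both orders of [inl j] and the
    image of [v], and exactly one of these two values is 1. This is the sign between a side face of
    a prism and the prism over a face. *)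
Lemma sign_prism_face s (j : 'I_(sdim s).+1) (c : {set bvertex s}) v :
  inl j \in c -> v \in split_cell j c -> bvertex_map (dbl_proj s) v != inl j ->
  is_cell (c :\ bvertex_map (dbl_proj s) v) ->
  odd (sign_exponent c (inl j) + sign_exponent (prism_cell j c) v) =
  ~~ odd (sign_exponent c (bvertex_map (dbl_proj s) v) +
          sign_exponent (c :\ bvertex_map (dbl_proj s) v) (inl j)).
Proof.
move=> jc vc vj cvc; rewrite sign_exponent_prism //.
have pvc : bvertex_map (dbl_proj s) v \in c by move: vc; rewrite in_set => /andP[].
rewrite (sign_exponentD1 _ pvc); last first.
  by case/andP: cvc => /allP/(_ _ (stratum_in _)).
rewrite (before_total vj).
move: (sign_exponent (c :\ _) _) (sign_exponent c _) => x y.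
by rewrite !oddD !oddb; case: (before _ _) (odd x) (odd y) => [] [] [].
Qed.

Lemma subface m (A : {set 'I_m.+1}) : A != set0 ->
  exists k (g : nerve 'I_m.+1 k), injective g /\ forall i, i \in A <-> exists l, g l = i.
Proof.
move=> A0; have A_gt0 : (0 < size (enum A))%N by rewrite -cardE card_gt0.
have Ak : (size (enum A)).-1.+1 = size (enum A) by rewrite prednK.
have lt_enum (l : 'I_(size (enum A)).-1.+1) : (l < size (enum A))%N by rewrite -[X in (_ < X)%N]Ak.
have A_sorted : sorted ltn (map val (enum A)).
  rewrite sorted_map {1}/enum_mem -enumT; apply: sorted_filter.
    by move=> a b c /= ba; apply: ltn_trans ba.
  by rewrite -sorted_map val_enum_ord iota_ltn_sorted.
have g_mono : monotoneb [ffun l : 'I_(size (enum A)).-1.+1 => nth ord0 (enum A) l].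
  apply/forallP => a; apply/forallP => b; apply/implyP => ab; rewrite !ffunE leEord.
  rewrite -!(nth_map _ 0%N val) //.
  have := sorted_leq_nth leq_trans leqnn 0%N (sub_sorted ltnW A_sorted).
  by apply; rewrite ?inE ?size_map.
exists _, (Chain g_mono); split=> [a b|i].
  rewrite !ffunE => /eqP; rewrite nth_uniq ?enum_uniq // => /eqP ab; exact: val_inj.
split=> [iA|[l <-]]; last by rewrite ffunE -mem_enum mem_nth.
have iE : (index i (enum A) < (size (enum A)).-1.+1)%N by rewrite Ak index_mem mem_enum.
by exists (Ordinal iE); rewrite ffunE nth_index // mem_enum.
Qed.
End Prism.

(** * Integration over the interval *)

Section PrismOperator.
Variables (R : comPzRingType) (d : Order.disp_t) (P : porderType d).
Implicit Types (s t : simplex P).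

(** An element over [s] of the path object, stripped of allowability. Naturality is stated for
    regular sources, where the restriction of the presheaf is [cochain_map]. *)
Record cylinder_cocycle s (n : nat) := CylinderCocycle {
  cyl :> forall t, simplex_hom t s -> nerve 'I_2 (sdim t) -> cochain R t n;
  cyl_nat : forall t t' (g : simplex_hom t' t) f phi, regular t' ->
    cochain_map g (@cyl t f phi) = @cyl t' (simplex_comp f g) (ncomp phi g);
  cyl_cocycle : forall t f phi, coboundary (@cyl t f phi) = 0 }.

(* The two values restrict to the same cochain on the face of [t] spanned by the
   vertices of [c] which are not apexes. *)
Lemma cyl_local s n (F : cylinder_cocycle s n) t (f : simplex_hom t s)
    (phi psi : nerve 'I_2 (sdim t))
    (c : {set bvertex t}) : regular t ->
  (forall i, inl i \in c -> phi i = psi i) ->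
  coord (F t f phi) c = coord (F t f psi) c.
Proof.
move=> t_reg eq_c; have [/andP[cc /eqP cn]|cN] := boolP (is_cell c && (cell_dim c == n));
  last by rewrite !coord_out.
have [i0 i0c i0top] := cell_base cc.
have A0 : [set i | inl i \in c] != set0 by apply/set0Pn; exists i0; rewrite inE.
have [k [g [g_inj gA]]] := subface A0.
pose t0 := Simplex (ncomp t g); pose h : simplex_hom t0 t := @SimplexHom _ _ t0 t g erefl.
pose c0 := [set v | bvertex_map h v \in c].
(* The face contains a vertex of [c] over the last stratum, so it ends in that stratum and stays
   regular. *)
have top0 : t0 ord_max = t ord_max.
  have /gA[l gl] : i0 \in [set i | inl i \in c] by rewrite inE.
  apply: le_anti; rewrite -{2}i0top -gl ffunE; apply/andP; split.
    by apply: chain_le; apply: leq_ord.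
  by apply: chain_le; apply: (chain_le g); apply: leq_ord.
have t0_reg : regular t0 by rewrite /regular top0.
have h_inj : injective (bvertex_map h).
  by move=> [i|x] [j|y] //= [] => [/g_inj ->|xy] //; congr inr; apply: val_inj.
(* Over a stratum of [t] that the face does not meet, the non-empty block of [c] can only be the
   apex, which is just what [cell_map] inserts. *)
have hc0 : cell_map h c0 = c.
  apply/setP => v; rewrite in_setU; apply/orP/idP => [[/imsetP[u]|/imsetP[x]]|vc].
  - by rewrite inE => uc ->.
  - rewrite inE => xN ->; case/andP: cc => /allP/(_ _ (ssvalP x))/set0Pn[u] + _.
    rewrite inE => /andP[uc /eqP ux]; case: u uc ux => [i|y] ic /= ix.
      have /gA[l gl] : i \in [set i | inl i \in c] by rewrite inE.
      by case/negP: xN; apply/strataP; exists l; rewrite ffunE gl.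
    by rewrite (_ : x = y) //; apply: val_inj.
  - case: v vc => [i|x] vc.
      have /gA[l gl] : i \in [set i | inl i \in c] by rewrite inE.
      by left; apply/imsetP; exists (inl l); rewrite ?inE /= gl.
    have [xs|xs] := boolP (ssval x \in strata t0); last first.
      by right; apply/imsetP; exists x; rewrite ?inE.
    left; apply/imsetP; have xE : inr x = bvertex_map h (inr (SeqSub xs)).
      by congr inr; apply: val_inj.
    by exists (inr (SeqSub xs)); rewrite // inE -xE.
have cc0 : is_cell c0 by rewrite -(is_cell_map h) // hc0.
have cn0 : cell_dim c0 = n by rewrite -(cell_dim_map_eq (in2W h_inj)) hc0.
rewrite -hc0 -!coord_cochain_map ?cn0 // !cyl_nat //.
congr (coord (F _ _ _) _); apply: nerveP => l; rewrite !ffunE; apply: eq_c.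
have : g l \in [set i | inl i \in c] by apply/gA; exists l.
by rewrite inE.
Qed.

(** The classical alternating sum over [v_0, ..., v_j, w_j, ..., w_n], with the Koszul sign. The
    jump at [j.*2.+1] puts the lower copy [j.*2] at the end 0 and the upper copy at the end 1;
    apexes are not doubled and index no term. *)
Definition prism s n (F : cylinder_cocycle s n.+1) : cochain R s n :=
  [ffun c : cell s n => \sum_(j | inl j \in val c)
    (-1) ^+ sign_exponent (val c) (inl j) *
    coord (F (dbl s) (dbl_proj s) (step _ j.*2.+1)) (prism_cell j (val c))].

(** If [c] is not a cell of dimension [n], its prisms are not cells of dimension [n.+1] and both
    sides vanish; so the formula applies to every face of a cell. *)
Lemma coord_prism s n (F : cylinder_cocycle s n.+1) (c : {set bvertex s}) :
  coord (prism F) c = \sum_(j | inl j \in c)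
    (-1) ^+ sign_exponent c (inl j) *
    coord (F (dbl s) (dbl_proj s) (step _ j.*2.+1)) (prism_cell j c).
Proof.
have [cP|cN] := boolP (is_cell c && (cell_dim c == n)).
  by rewrite [c]/(val (exist _ c cP : cell s n)) coordE ffunE.
rewrite coord_out // big1 // => j jc; rewrite coord_out ?mulr0 //.
rewrite is_cell_prism //; apply: contra cN => /andP[cc].
by rewrite cell_dim_prism // eqSS cc.
Qed.

Lemma dbl_regular s : regular s -> regular (dbl s).
Proof. by rewrite /regular dbl_top. Qed.

(** Split at 0, a cell consists of upper copies and the step is constant 1; split past the last
    vertex, as in the next lemma, it consists of lower copies and the step is constant 0. These are
    the two ends of the cylinder. *)
Lemma coord_cyl_split0 s n (F : cylinder_cocycle s n) (c : {set bvertex s}) :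
  regular s -> is_cell c -> cell_dim c = n ->
  coord (F (dbl s) (dbl_proj s) (step _ 0)) (split_cell 0 c) =
  coord (F s (simplex_id s) (ncst (sdim s) ord_max)) c.
Proof.
move=> s_reg cc cn.
rewrite -[in RHS](imset_split_cell 0 c) -cell_map_proj.
rewrite -coord_cochain_map ?is_cell_split ?cell_dim_split ?cn // cyl_nat; last exact: dbl_regular.
congr (coord (F _ _ _) _); first by apply: simplex_hom_eq => i; rewrite !ffunE.
by apply: nerveP => i; rewrite !ffunE.
Qed.

Lemma coord_cyl_split_top s n (F : cylinder_cocycle s n) (c : {set bvertex s}) :
  regular s -> is_cell c -> cell_dim c = n ->
  coord (F (dbl s) (dbl_proj s) (step _ (sdim s).+1.*2)) (split_cell (sdim s).+1 c) =
  coord (F s (simplex_id s) (ncst (sdim s) ord0)) c.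
Proof.
move=> s_reg cc cn.
rewrite -[in RHS](imset_split_cell (sdim s).+1 c) -cell_map_proj.
rewrite -coord_cochain_map ?is_cell_split ?cell_dim_split ?cn // cyl_nat; last exact: dbl_regular.
congr (coord (F _ _ _) _); first by apply: simplex_hom_eq => i; rewrite !ffunE.
by apply: nerveP => i; rewrite !ffunE leqNgt ltn_ord.
Qed.

(** Stokes' formula. The cocycle condition on the prism at [j] expresses the difference
    [V j - V j.+1] of its inner faces by its side faces, which are the prisms over the faces of [c].
    Summed over [j], the differences telescope to the two ends. *)
Lemma coboundary_prism s n (F : cylinder_cocycle s n.+1) : regular s ->
  coboundary (prism F) = F s (simplex_id s) (ncst (sdim s) ord_max) -
                         F s (simplex_id s) (ncst (sdim s) ord0).
Proof.
move=> s_reg; apply: cochain_coordP => c cc cn; rewrite coordB.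
have sd_reg := dbl_regular s_reg.
pose V a := coord (F (dbl s) (dbl_proj s) (step _ a.*2)) (split_cell a c).
pose h (j : 'I_(sdim s).+1) := F (dbl s) (dbl_proj s) (step _ j.*2.+1).
(* The step at [j.*2.+1] differs from those at [j.*2] and [j.+1.*2] only at the lower, respectively
   upper, copy of [j], the one missing from the face in question. *)
have V_lower j : inl j \in c -> coord (h j) (split_cell j c) = V j.
  move=> jc; apply: cyl_local => // i; rewrite in_set !ffunE => /andP[_ /eqP ji].
  congr (if _ then _ else _); move: ji; rewrite -[in X in _ -> X](odd_double_half i).
  by case: (odd i) => /= ji; lia.
have V_upper j : inl j \in c -> coord (h j) (split_cell j.+1 c) = V j.+1.
  move=> jc; apply: cyl_local => // i; rewrite in_set !ffunE => /andP[_ /eqP ji].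
  congr (if _ then _ else _); move: ji; rewrite -[in X in _ -> X](odd_double_half i).
  by case: (odd i) => /= ji; lia.
(* Vertices outside [c] do not change [V], so the telescoping sum may run over all [j]. *)
have V_const (j : 'I_(sdim s).+1) : inl j \notin c -> V j = V j.+1.
  move=> jc; rewrite /V split_cellS //; apply: cyl_local => // i.
  rewrite in_set !ffunE => /andP[/= ic /eqP ji].
  have {ic} : halves _ i != j by apply: contraNneq jc => <-.
  rewrite -val_eqE /= halves_val => ij.
  congr (if _ then _ else _); move: ji ij; rewrite -[in X in _ -> _ -> X](odd_double_half i).
  by case: (odd i) => /= ji; lia.
have face (j : 'I_(sdim s).+1) : inl j \in c ->
    \sum_(v in c | v != inl j) (-1) ^+ sign_exponent c v *
       ((-1) ^+ sign_exponent (c :\ v) (inl j) * coord (h j) (prism_cell j (c :\ v)))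
    = V j - V j.+1.
  move=> jc; have pc := is_cell_prism jc; rewrite cc in pc.
  have pn : cell_dim (prism_cell j c) = n.+2 by rewrite cell_dim_prism // cn.
  have := coboundaryE (h j) pc pn; rewrite cyl_cocycle coord0.
  rewrite (bigD1 (inl (lower j))) ?lower_in_prism //=.
  rewrite (bigD1 (inl (upper j))) /=; last first.
    rewrite upper_in_prism //=; by apply/eqP => -[]; lia.
  rewrite prism_cellD_lower prism_cellD_upper // V_lower // V_upper //.
  rewrite sign_exponent_prism_lower // sign_exponent_prism_upper //.
  set S := (X in _ = _ + (_ + X) -> _) => /esym eq0.
  have SE : S = - ((-1) ^+ sign_exponent c (inl j) * (V j - V j.+1)).
    apply: (addrI ((-1) ^+ sign_exponent c (inl j) * (V j - V j.+1))).
    by rewrite subrr; apply: etrans eq0; rewrite exprS mulN1r mulNr mulrBr addrA.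
  have -> : V j - V j.+1 = - (-1) ^+ sign_exponent c (inl j) * S.
    by rewrite SE mulNr mulrN opprK mulrA -expr2 sqrr_sign mul1r.
  rewrite /S mulr_sumr.
  rewrite -{1}(imset_split_cell j c) big_imset_cond /=; last first.
    by move=> u v; apply: bvertex_proj_inj.
  apply: eq_big => [v|v /andP[vc vj]]; last first.
    have [cvc|cvN] := boolP (is_cell (c :\ bvertex_map (dbl_proj s) v)); last first.
      have jcv : inl j \in c :\ bvertex_map (dbl_proj s) v by rewrite !inE eq_sym vj.
      rewrite prism_cellD // coord_out ?mulr0 // negb_and.
      by rewrite is_cell_prism // cvN.
    rewrite prism_cellD // !mulrA -!exprD mulNr -exprD.
    rewrite -[in RHS]signr_odd sign_prism_face // -[in LHS]signr_odd.
    by case: (odd _); rewrite ?expr0 ?expr1 ?opprK ?mul1r ?mulN1r.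
  have [vs|vs] := boolP (v \in split_cell j c); last first.
    rewrite /prism_cell in_setU1 (negPf vs) orbF; by case: (v == _).
  rewrite /prism_cell in_setU1 vs orbT /=.
  have vl : v != inl (lower j).
    by apply: contraTneq vs => ->; rewrite inE /= doubleK leqnn odd_double andbF.
  rewrite vl /=; congr (~~ _); apply/eqP/eqP => [vj|->]; last first.
    by rewrite /= halves_upper.
  apply: bvertex_proj_inj vs (upper_in_split jc) _.
  by rewrite vj /= halves_upper.
rewrite -coord_cyl_split0 // -coord_cyl_split_top // -/(V 0%N) -/(V (sdim s).+1).
have -> : V 0%N - V (sdim s).+1 = \sum_(j < (sdim s).+1) (V j - V j.+1).
  elim: (sdim s).+1 => [|m IH]; first by rewrite big_ord0 subrr.
  by rewrite big_ord_recr /= -IH addrA subrK.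
rewrite (bigID (fun j : 'I_(sdim s).+1 => inl j \in c)) /= [X in _ = _ + X]big1 ?addr0; last first.
  by move=> j jc; rewrite V_const // subrr.
rewrite coboundaryE //.
under [LHS]eq_bigr => v vc do rewrite coord_prism mulr_sumr.
rewrite (exchange_big_dep (fun j : 'I_(sdim s).+1 => inl j \in c)) /=; last first.
  by move=> v j _; rewrite inE => /andP[].
apply: eq_bigr => j jc; rewrite -face //; apply: eq_bigl => v.
by rewrite inE in_set1 jc andbT eq_sym.
Qed.

(** Face dimensions can only drop under [f], and a stratum that [s] does not meet receives an apex,
    hence degree [-oo]. This is applied to the projection of a prism onto its cell. *)
Lemma perverse_degree_cell_image s t (f : simplex_hom s t) (c : {set bvertex s}) x :
  s ord_max = t ord_max ->
  (perverse_degree_cell (cell_map f c) x <= perverse_degree_cell c x)%O.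
Proof.
move=> st; rewrite /perverse_degree_cell st; case: ifP => // _.
case: ifP => [/andP[xt /existsPn no_apex]|_]; last exact: leNye.
have xs : x \in strata s.
  apply: contraT => xs; have := no_apex (inr (SeqSub xt)).
  by rewrite (block_map_new f c xt xs) inE eqxx.
rewrite ifT; last first.
  rewrite xs /=; apply/existsPn => v; have := no_apex (bvertex_map f v).
  rewrite block_map // is_apex_map; apply: contra => /andP[vc ->].
  by rewrite imset_f.
rewrite lee_fin lez_nat (big_strata_map f) => [|y]; last exact: face_dim_map_new.
by apply: leq_sum => y _; apply: face_dim_map.
Qed.

Lemma prism_allowable (p : perversity P) s n (F : cylinder_cocycle s n.+1) :
  (forall phi, allowable p (F (dbl s) (dbl_proj s) phi)) -> allowable p (prism F).
Proof.
move=> F_all; apply/allowableP => c x; rewrite coord_prism => sumN0.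
have [j /andP[jc Fj]] : exists j : 'I_(sdim s).+1, (inl j \in c) &&
    (coord (F (dbl s) (dbl_proj s) (step _ j.*2.+1)) (prism_cell j c) != 0).
  apply/existsP; apply: contraNT sumN0 => /existsPn F0; apply/eqP/big1 => j jc.
  by have := F0 j; rewrite jc negbK => /eqP ->; rewrite mulr0.
rewrite -(imset_prism_cell jc) -cell_map_proj.
apply: le_trans (perverse_degree_cell_image _ _ _ _) _; first exact: dbl_top.
by move/allowableP: (F_all (step _ j.*2.+1)); apply.
Qed.

(** * Naturality of integration *)

Lemma lift_step_mono m k (g : nerve 'I_m.+1 k) (i : 'I_k.+1) :
  monotoneb [ffun l : 'I_k.*2.+2 =>
    if (l <= i.*2)%N then lower (g (halves k l)) else upper (g (halves k l))].
Proof.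
apply/forallP => a; apply/forallP => b; apply/implyP => ab; rewrite !ffunE leEord.
have := chain_le g (chain_le (halves k) ab); rewrite leEord !ffunE => gab.
case: (leqP a) => ai; case: (leqP b) => bi /=.
- by rewrite leq_double.
- by apply: leqW; rewrite leq_double.
- by have := leq_trans (leq_trans ai ab) bi; rewrite ltnn.
- by rewrite ltnS leq_double.
Qed.

(* For [g] not injective there is no monotone map doubling [g]; this one
   depends on the position [i] of the step. *)
Definition lift_step m k (g : nerve 'I_m.+1 k) (i : 'I_k.+1) :
  nerve 'I_m.*2.+2 k.*2.+1 := Chain (lift_step_mono g i).

Lemma halves_lift_step m k (g : nerve 'I_m.+1 k) i l :
  halves m (lift_step g i l) = g (halves k l).
Proof.
by rewrite [lift_step g i l]ffunE; case: ifP => _; rewrite ?halves_lower ?halves_upper.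
Qed.

Lemma step_lift_step m k (g : nerve 'I_m.+1 k) i :
  ncomp (step m.*2.+1 (g i).*2.+1) (lift_step g i) = step k.*2.+1 i.*2.+1.
Proof.
apply: nerveP => l; rewrite !ffunE; congr (if _ then _ else _).
have [li|il] := leqP l i.*2 => /=.
  have /(chain_le g) : (halves k l <= i)%N by rewrite halves_val; lia.
  by rewrite leEord ffunE ltn_double ltnNge => ->.
have /(chain_le g) : (i <= halves k l)%N by rewrite halves_val; lia.
by rewrite leEord ffunE ltnS leq_double => ->.
Qed.

Lemma lift_hom_over s t (g : simplex_hom s t) i :
  ncomp (dbl t) (lift_step g i) = dbl s.
Proof. by apply: nerveP => l; rewrite ffunE [LHS]ffunE halves_lift_step simplex_homE [RHS]ffunE. Qed.

Definition lift_hom s t (g : simplex_hom s t) i : simplex_hom (dbl s) (dbl t) :=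
  @SimplexHom _ _ (dbl s) (dbl t) (lift_step g i) (lift_hom_over g i).

Lemma dbl_proj_lift s t (g : simplex_hom s t) i :
  simplex_comp (dbl_proj t) (lift_hom g i) = simplex_comp g (dbl_proj s).
Proof. by apply: simplex_hom_eq => l; rewrite [LHS]ffunE halves_lift_step [RHS]ffunE. Qed.

Lemma lift_hom_lower s t (g : simplex_hom s t) (i j : 'I_(sdim s).+1) :
  (j <= i)%N -> bvertex_map (lift_hom g i) (inl (lower j)) = inl (lower (g j)).
Proof. by move=> ji /=; rewrite ffunE halves_lower ifT //= leq_double. Qed.

Lemma lift_hom_upper s t (g : simplex_hom s t) (i j : 'I_(sdim s).+1) :
  (i <= j)%N -> bvertex_map (lift_hom g i) (inl (upper j)) = inl (upper (g j)).
Proof. by move=> ji /=; rewrite ffunE halves_upper ifF //=; lia. Qed.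

Lemma lower_in_prism_le s (i j : 'I_(sdim s).+1) (c : {set bvertex s}) :
  inl j \in c -> (j <= i)%N -> inl (lower j) \in prism_cell i c.
Proof.
move=> jc; rewrite leq_eqVlt => /predU1P[/val_inj ->|ji]; first exact: lower_in_prism.
by rewrite in_setU1 in_set /= halves_lower jc /= doubleK; apply/orP; right; lia.
Qed.

Lemma upper_in_prism_le s (i j : 'I_(sdim s).+1) (c : {set bvertex s}) :
  inl j \in c -> (i <= j)%N -> inl (upper j) \in prism_cell i c.
Proof.
by move=> jc ij; rewrite in_setU1 in_set /= halves_upper jc /=; apply/orP; right; lia.
Qed.

Lemma prism_cellP s (i : 'I_(sdim s).+1) (c : {set bvertex s}) v : inl i \in c ->
  v \in prism_cell i c ->
  [\/ exists j : 'I_(sdim s).+1, [/\ v = inl (lower j), inl j \in c & (j <= i)%N],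
      exists j : 'I_(sdim s).+1, [/\ v = inl (upper j), inl j \in c & (i <= j)%N]
    | exists x, v = inr x /\ bvertex_map (dbl_proj s) v \in c].
Proof.
move=> ic; rewrite in_setU1 => /predU1P[->|]; first by constructor 1; exists i.
rewrite in_set; case: v => [k|x] /andP[kc /eqP ki]; last by constructor 3; exists x.
have kE : k = if odd k then upper (halves _ k) else lower (halves _ k).
  apply: val_inj; case: ifP => k_odd /=; rewrite halves_val;
    by rewrite -[LHS]odd_double_half k_odd.
rewrite kE; have [k_odd|k_even] := boolP (odd k).
  by constructor 2; exists (halves _ k); split=> //; rewrite halves_val -ki k_odd.
constructor 1; exists (halves _ k); split=> //; rewrite halves_val.
by move: ki; rewrite (negPf k_even); lia.
Qed.

(** Suppose [g] identifies [j] < [k]. Two lower copies collide if [k <= i], two upper copies if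
    [i <= j]; otherwise [i] lies between them, has the same image, and the lower copies of [j] and
    [i] collide. *)
Lemma lift_hom_inj s t (g : simplex_hom s t) (i : 'I_(sdim s).+1) (c : {set bvertex s}) :
  inl i \in c -> {in prism_cell i c &, injective (bvertex_map (lift_hom g i))} ->
  {in c &, injective (bvertex_map g)}.
Proof.
move=> ic G_inj u v uc vc.
have main (j k : 'I_(sdim s).+1) : (j <= k)%N -> inl j \in c -> inl k \in c -> g j = g k -> j = k.
  move=> jk jc kc gjk; have [ki|ik] := leqP k i.
    have := G_inj _ _ (lower_in_prism_le jc (leq_trans jk ki)) (lower_in_prism_le kc ki).
    rewrite !lift_hom_lower ?(leq_trans jk ki) // gjk => /(_ erefl)[] E.
    by apply: val_inj => /=; lia.
  have [ij|ji] := leqP i j.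
    have := G_inj _ _ (upper_in_prism_le jc ij) (upper_in_prism_le kc (ltnW ik)).
    rewrite !lift_hom_upper ?(ltnW ik) // gjk => /(_ erefl)[] E.
    by apply: val_inj => /=; lia.
  have gij : g j = g i.
    apply: le_anti; rewrite (chain_le g (ltnW ji)) /= gjk; exact: (chain_le g (ltnW ik)).
  have := G_inj _ _ (lower_in_prism_le jc (ltnW ji)) (lower_in_prism_le ic (leqnn i)).
  by rewrite !lift_hom_lower ?(ltnW ji) // gij => /(_ erefl)[] E; lia.
case: u v uc vc => [j|x] [k|y] //= jc kc [].
  move=> gjk; congr inl; have [jk|/ltnW kj] := leqP j k; first exact: main.
  by apply/esym/main.
by move=> xy; congr inr; apply: val_inj.
Qed.

Lemma cell_map_lift s t (g : simplex_hom s t) (i : 'I_(sdim s).+1) (c : {set bvertex s}) :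
  inl i \in c -> {in c &, injective (bvertex_map g)} ->
  cell_map (lift_hom g i) (prism_cell i c) = prism_cell (g i) (cell_map g c).
Proof.
move=> ic g_inj.
have g_in (j : 'I_(sdim s).+1) : inl j \in c -> inl (g j) \in cell_map g c.
  by move=> jc; rewrite in_setU (imset_f (bvertex_map g) jc).
have g_le (j k : 'I_(sdim s).+1) : inl j \in c -> inl k \in c -> (g j <= g k)%N -> (j <= k)%N.
  move=> jc kc gjk; rewrite leqNgt; apply/negP => kj.
  have gE : g j = g k.
    by apply: le_anti; apply/andP; split; [exact: gjk | exact: (chain_le g (ltnW kj))].
  by have [jk] := g_inj _ _ jc kc (congr1 inl gE); rewrite jk ltnn in kj.
have new (x : seq_sub (strata t)) (x' : seq_sub (strata (dbl t))) : ssval x = ssval x' ->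
    bvertex_map (dbl_proj t) (inr x') = inr x.
  by move=> xx'; congr inr; apply: val_inj.
apply/setP => v; apply/idP/idP.
  rewrite in_setU => /orP[/imsetP[u uc ->]|/imsetP[x]].
    have [[j [-> jc ji]]|[j [-> jc ij]]|[x [-> xc]]] := prism_cellP ic uc.
    - by rewrite lift_hom_lower // lower_in_prism_le ?g_in //; apply: (chain_le g).
    - by rewrite lift_hom_upper // upper_in_prism_le ?g_in //; apply: (chain_le g).
    rewrite in_setU1 in_set -bvertex_map_comp dbl_proj_lift bvertex_map_comp andbT.
    by rewrite in_setU imset_f.
  rewrite inE dbl_strata => xN ->; rewrite in_setU1 in_set andbT in_setU.
  have xt : ssval x \in strata t by rewrite -dbl_strata ssvalP.
  apply/orP; right; apply/orP; right; apply/imsetP; exists (SeqSub xt); rewrite ?inE //.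
  exact: new.
move=> vc; have [[k [-> kc ki]]|[k [-> kc ik]]|[x [-> xc]]] := prism_cellP (g_in _ ic) vc.
- move: kc; rewrite in_setU => /orP[/imsetP[[j|//] jc [kj]]|/imsetP[//]].
  rewrite kj in ki *; rewrite in_setU; apply/orP; left; apply/imsetP.
  by exists (inl (lower j)); rewrite ?lift_hom_lower ?lower_in_prism_le ?g_le.
- move: kc; rewrite in_setU => /orP[/imsetP[[j|//] jc [kj]]|/imsetP[//]].
  rewrite kj in ik *; rewrite in_setU; apply/orP; left; apply/imsetP.
  by exists (inl (upper j)); rewrite ?lift_hom_upper ?upper_in_prism_le ?g_le.
rewrite in_setU; apply/orP; have [xs|xs] := boolP (ssval x \in strata (dbl s)); last first.
  by right; apply/imsetP; exists x; rewrite ?inE.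
have xE : bvertex_map (lift_hom g i) (inr (SeqSub xs)) = inr x.
  by congr inr; apply: val_inj.
left; apply/imsetP; exists (inr (SeqSub xs)) => //.
rewrite in_setU1 in_set andbT; apply/orP; right; move: xc; rewrite in_setU.
case/orP => /imsetP[].
  case=> [j|y] // yc /(congr1 (@stratum _ _ _)); rewrite !stratum_map /= => xy.
  by rewrite (_ : inr _ = inr y) //; congr inr; apply: val_inj.
move=> y; rewrite inE => yN /(congr1 (@stratum _ _ _)); rewrite stratum_map /= => xy.
by rewrite -xy -dbl_strata xs in yN.
Qed.

(** If [g] is injective on [c], the terms of the two sums correspond through [lift_hom]. If [g]
    folds [c], each lift folds the prism, so every term on the right is degenerate, like the value
    on the left. *)
Lemma prism_map s s' n (F : cylinder_cocycle s n.+1) (F' : cylinder_cocycle s' n.+1)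
    (g : simplex_hom s' s) : regular s' ->
  (forall t (f : simplex_hom t s') phi, F' t f phi = F t (simplex_comp g f) phi) ->
  cochain_map g (prism F) = prism F'.
Proof.
move=> s'_reg FF'; have s's := regular_hom g s'_reg.
have sd'_reg := dbl_regular s'_reg.
apply/ffunP => c; rewrite !ffunE; move: c => [c /= /andP[cc /eqP cn]].
have FE i : inl i \in c ->
    coord (F' (dbl s') (dbl_proj s') (step _ i.*2.+1)) (prism_cell i c) =
    coord (F (dbl s) (dbl_proj s) (step _ (g i).*2.+1))
      (cell_map (lift_hom g i) (prism_cell i c)).
  move=> ic; rewrite FF' -(dbl_proj_lift g i) -(step_lift_step g) -cyl_nat //.
  by rewrite coord_cochain_map ?is_cell_prism ?cell_dim_prism ?cn.
have [/dinjectiveP g_inj|/dinjectiveP g_ninj] := boolP (dinjectiveb (bvertex_map g) (mem c)).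
  have g_injI : {in [set i | inl i \in c] &, injective g}.
    move=> i j; rewrite !inE => ic jc gij.
    by have [] := g_inj _ _ ic jc (congr1 inl gij).
  rewrite coord_prism; have -> : \sum_(j | inl j \in cell_map g c)
      (-1) ^+ sign_exponent (cell_map g c) (inl j) *
      coord (F (dbl s) (dbl_proj s) (step _ j.*2.+1)) (prism_cell j (cell_map g c)) =
    \sum_(j in g @: [set i | inl i \in c])
      (-1) ^+ sign_exponent (cell_map g c) (inl j) *
      coord (F (dbl s) (dbl_proj s) (step _ j.*2.+1)) (prism_cell j (cell_map g c)).
    apply: eq_bigl => j; rewrite in_setU; apply/orP/imsetP.
      by case=> /imsetP[] // -[i|x] // ic [->]; exists i; rewrite ?inE.
    by case=> i; rewrite inE => ic ->; left; apply/imsetP; exists (inl i).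
  rewrite big_imset //=; apply: eq_big => [i|i]; rewrite inE // => ic.
  rewrite FE // cell_map_lift //; congr (_ ^+ _ * _).
  exact: (sign_exponent_map g_inj ic).
rewrite coord_out ?big1 // => [i ic|]; last first.
  rewrite is_cell_map // cc /=; apply/eqP => gn; apply: g_ninj.
  by apply: cell_map_inj; rewrite ?gn.
rewrite FE // coord_out ?mulr0 //; apply/negP => /andP[_ /eqP Gn]; apply: g_ninj.
apply: (lift_hom_inj ic); apply: cell_map_inj; rewrite ?is_cell_prism //.
by rewrite Gn cell_dim_prism // cn.
Qed.

(** A face that keeps both copies of [j] is degenerate for a cochain pulled back from [s], and the
    face without the upper copy is cut off because it has a vertex at the end 0. The face without
    the lower copy survives only if no vertex of [c] other than apexes precedes [j]; there the two
    signs agree and cancel. *)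
Lemma prism_suspension s n (F : cylinder_cocycle s n.+1) (w : cochain R s n) :
  (forall phi, F (dbl s) (dbl_proj s) phi =
    coboundary (cutoff phi (cochain_map (dbl_proj s) w))) ->
  prism F = w.
Proof.
move=> FE; apply: cochain_coordP => c cc cn; rewrite coord_prism.
have collapse0 (i : 'I_(sdim s).+1) (e : {set bvertex (dbl s)}) :
    inl (lower i) \in e -> inl (upper i) \in e ->
    coord (cochain_map (dbl_proj s) w) e = 0.
  move=> le ue; have [/andP[ec /eqP en]|/coord_out-> //] := boolP (is_cell e && (cell_dim e == n)).
  rewrite coord_cochain_map ?en // coord_out // negb_and; apply/orP; right.
  apply/eqP => pen; have p_inj : {in e &, injective (bvertex_map (dbl_proj s))}.
    by apply: cell_map_inj; rewrite ?pen.
  have := p_inj _ _ le ue; rewrite /= halves_lower halves_upper => /(_ erefl)[].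
  by lia.
have [i0 i0c _] := cell_base cc.
pose i := [arg min_(j < i0 | inl j \in c) (j : nat)].
have [ic i_min] : inl i \in c /\ forall j : 'I_(sdim s).+1, inl j \in c -> (i <= j)%N.
  by rewrite /i; case: arg_minnP.
have term (j : 'I_(sdim s).+1) : inl j \in c ->
    coord (F (dbl s) (dbl_proj s) (step _ j.*2.+1)) (prism_cell j c) =
    (-1) ^+ sign_exponent c (inl j) * (if j == i then coord w c else 0).
  move=> jc; rewrite FE coboundaryE ?is_cell_prism ?cell_dim_prism ?cn //.
  rewrite (bigD1 (inl (lower j))) ?lower_in_prism //= sign_exponent_prism_lower //.
  rewrite big1 ?addr0 => [|v /andP[vc vl]]; last first.
    rewrite coord_cutoff; have [->|vu] := eqVneq v (inl (upper j)).
      rewrite prism_cellD_upper // ifF ?mulr0 //; apply/forallP => /(_ (lower j)).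
      by rewrite lower_in_split // ffunE /= ltnn.
    rewrite (collapse0 j) ?if_same ?mulr0 // in_setD1 eq_sym ?vl ?vu ?lower_in_prism //=.
    exact: upper_in_prism.
  congr (_ * _); rewrite coord_cutoff prism_cellD_lower.
  rewrite coord_cochain_map ?is_cell_split ?cell_dim_split ?cn //.
  rewrite cell_map_proj imset_split_cell; congr (if _ then _ else _).
  apply/forallP/eqP => [all1 | -> k].
    apply: val_inj; apply/eqP; rewrite eqn_leq i_min // andbT leqNgt; apply/negP => ij.
    have := all1 (lower i); rewrite in_set /= halves_lower ic ffunE /= doubleK odd_double.
    by rewrite leqNgt ij /= ltn_double ltnNge (ltnW ij).
  apply/implyP; rewrite in_set => /andP[/= kc /eqP ki].
  have := i_min _ kc; rewrite halves_val -ki => k_odd.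
  have ik : (i <= k./2)%N by rewrite -ki.
  rewrite ffunE ifT // -[X in (_ < X)%N]odd_double_half k_odd add1n ltnS.
  by rewrite leq_double.
rewrite (bigD1 i) //= term // eqxx mulrA -expr2 sqrr_sign mul1r big1 ?addr0 //.
by move=> j /andP[jc /negPf ji]; rewrite term // ji !mulr0.
Qed.
End PrismOperator.

(** * The square of the coboundary *)

Lemma block_faceN (d : Order.disp_t) (P : porderType d) (s : simplex P)
    (c : {set bvertex s}) u v :
  is_cell (c :\ u :\ v) -> block (c :\ u) (stratum u) != set0.
Proof.
case/andP => /allP/(_ _ (stratum_in u)) /set0Pn[w]; rewrite !inE.
move=> /andP[/andP[_ wc] wu] _; apply/set0Pn; exists w.
by rewrite !inE wc wu.
Qed.

Lemma is_cellD1 (d : Order.disp_t) (P : porderType d) (s : simplex P)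
    (c : {set bvertex s}) u :
  is_cell c -> block (c :\ u) (stratum u) != set0 -> is_cell (c :\ u).
Proof.
move=> /andP[/allP c0 apexN] uN; apply/andP; split.
  apply/allP => x xs; have [->//|xu] := eqVneq x (stratum u).
  have /set0Pn[w wc] := c0 _ xs; apply/set0Pn; exists w; move: wc.
  rewrite !inE => /andP[-> /eqP wx]; rewrite wx eqxx !andbT.
  by apply: contraNneq xu => <-; rewrite wx.
apply: contra apexN => /existsP[w /andP[wc wa]]; apply/existsP; exists w.
by move: wc; rewrite !inE wa => /andP[/andP[_ ->] ->].
Qed.

(** The pairs of removed vertices are sorted by which of the two comes first in [before]; exchanging
    them changes the sign, by [sign_exponentD1]. *)
Lemma coboundaryK (R : comPzRingType) (d : Order.disp_t) (P : porderType d)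
    (s : simplex P) n (w : cochain R s n) : coboundary (coboundary w) = 0.
Proof.
apply: cochain_coordP => c cc cn; rewrite coboundaryE // coord0.
pose a u v := (-1) ^+ sign_exponent c u *
  ((-1) ^+ sign_exponent (c :\ u) v * coord w (c :\ u :\ v)).
have dE u : u \in c -> (-1) ^+ sign_exponent c u * coord (coboundary w) (c :\ u) =
    \sum_(v in c | before u v) a u v + \sum_(v in c | before v u) a u v.
  move=> uc; have -> : coord (coboundary w) (c :\ u) =
      \sum_(v in c :\ u) (-1) ^+ sign_exponent (c :\ u) v * coord w (c :\ u :\ v).
    (* If [c :\ u] is not a cell, neither is any [c :\ u :\ v], so the coboundary formula still
       holds there, with all terms 0. *)
    have [cu|cu] := boolP (is_cell (c :\ u)).
      by rewrite coboundaryE //; have := face_dimD1 uc cu; rewrite cn => -[].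
    rewrite coord_out ?(negPf cu) // big1 // => v vc; rewrite coord_out ?mulr0 //.
    apply: contra cu => /andP[cuv _]; exact: is_cellD1 cc (block_faceN cuv).
  rewrite mulr_sumr (bigID (before u)) /=; congr (_ + _); apply: eq_bigl => v.
    rewrite !inE; have [->|//] := eqVneq v u.
    rewrite /before ltxx eqxx /=; case: u {uc} => [i|x] /=; last by rewrite andbF.
    by rewrite ltnn andbF.
  rewrite !inE; have [->|vu] := eqVneq v u.
    rewrite /before ltxx eqxx /=; case: u {uc} => [i|x] /=; last by rewrite andbF.
    by rewrite ltnn andbF.
  by rewrite (before_total (u := u)) // eq_sym.
rewrite (eq_bigr _ dE) big_split /= [X in _ + X](exchange_big_dep (mem c)) /=; last first.
  by move=> u v _ /andP[].
rewrite -big_split /= big1 // => u uc.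
rewrite [X in _ + X](eq_bigl (fun v => (v \in c) && before u v)); last first.
  by move=> v; rewrite uc.
rewrite -big_split /= big1 // => v /andP[vc uv].
have vuN : before v u = false.
  rewrite (before_total (u := u)) ?uv //; apply: contraTneq uv => ->.
  by rewrite /before ltxx eqxx /=; case: (v) => [i|x] /=; rewrite ?ltnn.
have cvu : c :\ v :\ u = c :\ u :\ v by rewrite !setDDl setUC.
rewrite /a cvu; have [/andP[cuv _]|/coord_out->] := boolP (is_cell (c :\ u :\ v) &&
  (cell_dim (c :\ u :\ v) == n)); last by rewrite !mulr0 addr0.
have cvu' := cuv; rewrite -cvu in cvu'.
rewrite (sign_exponentD1 v uc (block_faceN cuv)) (sign_exponentD1 u vc (block_faceN cvu')).
rewrite uv vuN addn0 addn1 exprS mulN1r mulNr [X in _ - X]mulrCA.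
by rewrite subrr.
Qed.

Program Definition psfst (C : category) (A B : presheaf C) : psmap (psprod A B) A :=
  @PsMap C (psprod A B) A (fun a x => x.1) _.
Next Obligation. by []. Qed.

Program Definition pssnd (C : category) (A B : presheaf C) : psmap (psprod A B) B :=
  @PsMap C (psprod A B) B (fun a x => x.2) _.
Next Obligation. by []. Qed.

Lemma nmeet_mono k (x y : nerve 'I_2 k) :
  monotoneb [ffun i => if x i == ord0 then ord0 else y i].
Proof.
apply/forallP => i; apply/forallP => j; apply/implyP => ij; rewrite !ffunE.
have [_|xi] := eqVneq (x i) ord0; first by rewrite leEord.
rewrite ifN; first exact: chain_le.
by have := chain_le x ij; rewrite leEord -!val_eqE -!lt0n /= in xi *; apply: leq_trans.
Qed.

(** The pointwise minimum, which contracts Δ[1] to its vertex 0. *)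
Definition nmeet k (x y : nerve 'I_2 k) : nerve 'I_2 k := Chain (nmeet_mono x y).

Program Definition stdmeet (C : category) (D : functor C Delta) (A : presheaf C) :
    psmap (tensor D (tensor D A (stdsimplex 1)) (stdsimplex 1)) (tensor D A (stdsimplex 1)) :=
  @PsMap C (tensor D (tensor D A (stdsimplex 1)) (stdsimplex 1)) (tensor D A (stdsimplex 1))
    (fun a x => (x.1.1, nmeet x.1.2 x.2)) _.
Next Obligation.
by move=> C D A a b f x; congr (_, _); apply: nerveP => i; rewrite !ffunE.
Qed.

(** * Loop spaces *)

Section LoopSpaces.
Variables (R : comPzRingType) (d : Order.disp_t) (P : porderType d).
Variables (p : perversity P) (C : category) (I : functor C (DeltaP P)).

Let D : functor C Delta := functor_comp (dimP P) I.
Let K n : presheaf C := restrict I (EM R p n).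

(** Cut-offs and integrals of paths are in general not cocycles; they live here, and [cob] brings
    them back to cocycles. *)
Program Definition cochains n : presheaf (DeltaP P) :=
  @Presheaf (DeltaP P) (fun s => {w : cochain R s n | Ntilde p w})
    (fun s t f w => exist _ (Ntilde_map f (sval w))
                          (Ntilde_map_Ntilde f (svalP w))) _ _.
Next Obligation.
move=> n s [w [w_all wN]]; apply: eq_exist => /=; rewrite /Ntilde_map.
by case: asboolP => s_reg; [apply: cochain_map_id | rewrite wN].
Qed.
Next Obligation.
move=> n s t u g f [w wP]; apply: eq_exist => /=; rewrite /Ntilde_map.
case: asboolP => s_reg //; have t_reg := regular_target f s_reg.
by rewrite (asboolT t_reg); apply: cochain_map_comp; apply: regular_hom.
Qed.

Let E n : presheaf C := restrict I (cochains n).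

Lemma cochains_eq n a (x y : E n a) : sval x = sval y -> x = y.
Proof. by case: x y => x xP [y yP] /= xy; apply: eq_exist. Qed.

Lemma cocycles_eq n a (x y : K n a) : sval x = sval y -> x = y.
Proof. by case: x y => x xP [y yP] /= xy; apply: eq_exist. Qed.

Lemma cocycle_not_regular n a (x : K n a) : ~ regular (I a) -> sval x = 0.
Proof. by case: x => x [[_ x0] _] /= /x0. Qed.

Lemma EM_kan (Z : presheaf C) n : kan (HomDelta D Z (K n)).
Proof.
have malP a (x y z : K n a) :
    Ntilde p (sval x - sval y + sval z) /\ coboundary (sval x - sval y + sval z) = 0.
  have [[[xN x0] [yN y0]] [zN z0]] := (svalP x, svalP y, svalP z).
  split; first by apply: NtildeD zN; apply: NtildeB.
  by rewrite coboundaryD coboundaryB x0 y0 z0 subr0 addr0.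
pose mal a x y z : K n a := exist _ _ (malP a x y z).
have mal_nat a b (f : hom a b) x y z :
    mal a (act f x) (act f y) (act f z) = act f (mal b x y z).
  by apply: cocycles_eq => /=; rewrite Ntilde_mapD Ntilde_mapB.
pose m k (x y z : HomDelta D Z (K n) k) : HomDelta D Z (K n) k :=
  @PsMap C (tensor D Z (stdsimplex k)) (K n) (fun a u => mal a (x a u) (y a u) (z a u))
    (fun a b f u => etrans
       (f_equal3 (mal a) (psnat x f u) (psnat y f u) (psnat z f u)) (mal_nat a b f _ _ _)).
apply: (@malcev_kan _ m).
- by move=> k l f x y z; apply: psmap_eq.
- move=> k x y; apply: psmap_eq => a u; apply: cocycles_eq => /=.
  by rewrite subrK.
- move=> k x y; apply: psmap_eq => a u; apply: cocycles_eq => /=.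
  by rewrite subrr add0r.
Qed.

Lemma cob_subproof n (s : simplex P) (w : cochain R s n) : Ntilde p w ->
  Ntilde p (coboundary w) /\ coboundary (coboundary w) = 0.
Proof.
move=> [w_all w0]; split; last exact: coboundaryK.
split=> s_reg; last by rewrite w0 // coboundary0.
have [_ dw] := w_all s_reg; split=> //; rewrite coboundaryK; exact: allowable0.
Qed.

Program Definition cob n : psmap (E n) (K n.+1) :=
  @PsMap C (E n) (K n.+1) (fun a w => exist _ _ (cob_subproof (svalP w))) _.
Next Obligation.
by move=> n a b f w; apply: cocycles_eq; rewrite /= Ntilde_map_coboundary.
Qed.

Program Definition cut n : psmap (tensor D (E n) (stdsimplex 1)) (E n) :=
  @PsMap C (tensor D (E n) (stdsimplex 1)) (E n)
    (fun a w => exist _ _ (cutoff_Ntilde w.2 (svalP w.1))) _.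
Next Obligation.
move=> n a b f w; apply: cochains_eq; rewrite /= /Ntilde_map.
by case: asboolP => _; [rewrite cutoff_map | rewrite cutoff0].
Qed.

Program Definition addE n : psmap (psprod (E n) (E n)) (E n) :=
  @PsMap C (psprod (E n) (E n)) (E n)
    (fun a w => exist _ _ (NtildeD (svalP w.1) (svalP w.2))) _.
Next Obligation. by move=> *; apply: cochains_eq; rewrite /= Ntilde_mapD. Qed.

Program Definition subE n : psmap (psprod (E n) (E n)) (E n) :=
  @PsMap C (psprod (E n) (E n)) (E n)
    (fun a w => exist _ _ (NtildeB (svalP w.1) (svalP w.2))) _.
Next Obligation. by move=> *; apply: cochains_eq; rewrite /= Ntilde_mapB. Qed.

Program Definition inclE n : psmap (K n) (E n) :=
  @PsMap C (K n) (E n) (fun a w => exist _ (sval w) (svalP w).1) _.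
Next Obligation. by move=> *; apply: cochains_eq. Qed.

(* The identity of Delta[P] and the inclusion of Delta[P]^+ both satisfy these;
   the values of a cocycle on non-regular simplices carry no information. *)
Hypothesis I_full : forall a b (f : simplex_hom (I a) (I b)), {u : hom a b | fmap I u = f}.
Hypothesis I_faithful : forall a b (u v : hom a b), fmap I u = fmap I v -> u = v.
Hypothesis I_regular : forall t : simplex P, regular t -> {a : C | I a = t}.

(** * Paths in the Eilenberg-MacLane objects and their integrals *)

Notation cyl n := (expo D (K n) (stdsimplex 1)).

Definition value_at n x (h : cyl n x) y t (e : I y = t) :
    simplex_hom t (I x) -> nerve 'I_2 (sdim t) -> cochain R t n :=
  match e in _ = t return
    simplex_hom t (I x) -> nerve 'I_2 (sdim t) -> cochain R t n with
  | erefl => fun f phi => sval (h y (sval (I_full f), phi))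
  end.

(** Integration evaluates a path on [dbl], a simplex of Δ[P] that is not given as the image of an
    object of [C]; so the path is extended to all simplices over [I x], by 0 on those that are not
    regular. *)
Definition value n x (h : cyl n x) t (f : simplex_hom t (I x))
    (phi : nerve 'I_2 (sdim t)) : cochain R t n :=
  match pselect (regular t) with
  | left t_reg => let: exist y e := I_regular t_reg in value_at h e f phi
  | right _ => 0
  end.

Lemma regular_ind (Q : simplex P -> Prop) :
  (forall y, regular (I y) -> Q (I y)) -> forall t, regular t -> Q t.
Proof. by move=> QI t t_reg; have [y e] := I_regular t_reg; case: _ / e in t_reg *; apply: QI. Qed.

(** The extra map [k] lets one statement give both independence of the chosen preimage of [t] ([k]
    the identity, in [valueE]) and naturality. *)
Lemma value_comp n x (h : cyl n x) y (u : hom y x) (phi : nerve 'I_2 (sdim (I y)))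
    t (k : simplex_hom t (I y)) : regular t ->
  value h (simplex_comp (fmap I u) k) (ncomp phi k) = cochain_map k (sval (h y (u, phi))).
Proof.
move=> t_reg; rewrite /value; case: pselect => // t_reg'.
case: (I_regular t_reg') => y' e /=; move: k t_reg {t_reg'}; case: _ / e => k k_reg /=.
have [v vk] := I_full k.
have -> : sval (I_full (simplex_comp (fmap I u) k)) = comp u v.
  apply: I_faithful; rewrite (svalP (I_full _)) fmap_comp vk //.
rewrite -vk; apply: etrans (congr1 sval (psnat h v (u, phi))) _.
by rewrite /= /Ntilde_map asboolT.
Qed.

Lemma valueE n x (h : cyl n x) y (u : hom y x) phi : regular (I y) ->
  value h (fmap I u) phi = sval (h y (u, phi)).
Proof.
move=> y_reg; have := value_comp h u phi (simplex_id (I y)) y_reg.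
rewrite cochain_map_id => <-; congr value.
  by apply: simplex_hom_eq => i; rewrite !ffunE.
by apply: nerveP => i; rewrite !ffunE.
Qed.

Lemma value_not_regular n x (h : cyl n x) t (f : simplex_hom t (I x)) phi :
  ~ regular t -> value h f phi = 0.
Proof. by rewrite /value; case: pselect. Qed.


Lemma value_nat n x (h : cyl n x) t t' (g : simplex_hom t' t) (f : simplex_hom t (I x)) phi :
  regular t' -> cochain_map g (value h f phi) = value h (simplex_comp f g) (ncomp phi g).
Proof.
move=> t'_reg; have t_reg := regular_target g t'_reg.
move: t t_reg g f phi; apply: regular_ind => y y_reg g f phi.
by have [u <-] := I_full f; rewrite valueE // value_comp.
Qed.

Lemma value_cocycle n x (h : cyl n x) t (f : simplex_hom t (I x)) phi :
  coboundary (value h f phi) = 0.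
Proof.
have [t_reg|t_nreg] := pselect (regular t); last first.
  by rewrite value_not_regular // coboundary0.
move: t t_reg f phi; apply: regular_ind => y y_reg f phi.
by have [u <-] := I_full f; rewrite valueE //; case: (svalP (h y (u, phi))).
Qed.

Lemma value_allowable n x (h : cyl n x) t (f : simplex_hom t (I x)) phi :
  allowable p (value h f phi).
Proof.
have [t_reg|t_nreg] := pselect (regular t); last first.
  by rewrite value_not_regular //; apply: allowable0.
move: t t_reg f phi; apply: regular_ind => y y_reg f phi.
have [u <-] := I_full f; rewrite valueE //; case: (svalP (h y (u, phi))) => [[w_all _] _].
by case: (w_all y_reg).
Qed.

Lemma value_act n x x' (u : hom x' x) (h : cyl n x) t (f : simplex_hom t (I x')) phi :
  value (act u h) f phi = value h (simplex_comp (fmap I u) f) phi.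
Proof.
have [t_reg|t_nreg] := pselect (regular t); last by rewrite !value_not_regular.
move: t t_reg f phi; apply: regular_ind => y y_reg f phi.
have [v <-] := I_full f; rewrite valueE //.
by rewrite -[simplex_comp _ _]/(comp (fmap I u) (fmap I v)) -fmap_comp valueE.
Qed.

Definition cylinder n x (h : cyl n x) : cylinder_cocycle R (I x) n :=
  @CylinderCocycle R d P (I x) n (value h) (@value_nat n x h) (@value_cocycle n x h).

Definition integral n x (h : cyl n.+1 x) : cochain R (I x) n :=
  if `[< regular (I x) >] then prism (cylinder h) else 0.

Lemma coboundary_integral n x (h : cyl n.+1 x) :
  coboundary (integral h) = sval (h x (idm x, ncst (sdim (I x)) ord_max)) -
                            sval (h x (idm x, ncst (sdim (I x)) ord0)).
Proof.
rewrite /integral; case: asboolP => x_reg; last first.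
  by rewrite coboundary0 !cocycle_not_regular // subrr.
rewrite coboundary_prism // -!valueE //.
by rewrite (fmap_id I x).
Qed.

Lemma integral_Ntilde n x (h : cyl n.+1 x) : Ntilde p (integral h).
Proof.
split=> x_reg; last by rewrite /integral; case: asboolP.
rewrite /integral asboolT //; split.
  by apply: prism_allowable => phi; apply: value_allowable.
by rewrite coboundary_prism //; apply: allowableB; apply: value_allowable.
Qed.

Program Definition integrate n : psmap (cyl n.+1) (E n) :=
  @PsMap C (cyl n.+1) (E n) (fun x h => exist _ _ (integral_Ntilde h)) _.
Next Obligation.
move=> n x x' u h; apply: cochains_eq => /=.
rewrite /Ntilde_map /integral; case: asboolP => x_reg //.
rewrite (asboolT (regular_target (fmap I u) x_reg)).
by apply/esym/prism_map => // t f phi; apply: value_act.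
Qed.

Lemma value0 n x (h : cyl n x) t (f : simplex_hom t (I x)) phi :
  (forall y u phi, sval (h y (u, phi)) = 0) -> value h f phi = 0.
Proof.
move=> h0; have [t_reg|t_nreg] := pselect (regular t); last exact: value_not_regular.
move: t t_reg f phi; apply: regular_ind => y y_reg f phi.
by have [u <-] := I_full f; rewrite valueE.
Qed.

Lemma integral0 n x (h : cyl n.+1 x) :
  (forall y u phi, sval (h y (u, phi)) = 0) -> integral h = 0.
Proof.
move=> h0; rewrite /integral; case: asboolP => // x_reg.
apply: cochain_coordP => c _ _; rewrite coord0 coord_prism big1 // => j _.
suff -> : cylinder h (dbl (I x)) (dbl_proj (I x)) (step _ j.*2.+1) = 0 by rewrite coord0 mulr0.
apply: value0 h0.
Qed.

Definition suspend n : psmap (K n) (cyl n.+1) :=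
  expo_curry (pscomp (cob n) (pscomp (cut n) (tensor_map D (inclE n) (psid (stdsimplex 1))))).

Lemma value_suspend n x (w : K n x) t (f : simplex_hom t (I x)) phi : regular t ->
  value (suspend n x w) f phi = coboundary (cutoff phi (cochain_map f (sval w))).
Proof.
move: t f phi; suff main t : regular t -> forall (f : simplex_hom t (I x)) phi,
    value (suspend n x w) f phi = coboundary (cutoff phi (cochain_map f (sval w))).
  by move=> t f phi /main.
move: t; apply: regular_ind => y y_reg f phi.
have [u <-] := I_full f; rewrite valueE //=.
by rewrite /Ntilde_map asboolT.
Qed.

Lemma integral_suspend n x (w : K n x) : integral (suspend n x w) = sval w.
Proof.
rewrite /integral; case: asboolP => x_reg; last by rewrite cocycle_not_regular.
apply: prism_suspension => phi; apply: value_suspend; exact: dbl_regular.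
Qed.

(** * Based loops, suspension and integration between them *)

Variable pt : forall n, psmap (final C) (K n).
Hypothesis pt0 : forall n a, sval (pt n a tt) = 0.

Let B n : pointed C := Pointed (pt n).

Definition loops n : psmap (Omega D (B n.+1)) (cyl n.+1) :=
  pscomp (psfst _ _) (subpresheaf_incl _).

(** The definition of [Omega] fixes the ends at the identity of [a]; naturality carries this to
    every [u]. *)
Lemma loops_ends n a (h : Omega D (B n.+1) a) b u (e : 'I_2) :
  sval (loops n a h b (u, ncst (D b) e)) = 0.
Proof.
have end0 : sval (loops n a h a (idm a, ncst (D a) e)) = 0.
  case: h => -[h []] /= [h0 h1]; case: e => -[|[|//]] e_lt.
    rewrite (_ : Ordinal e_lt = ord0); last exact: val_inj.
    by apply: etrans (congr1 sval h0) (pt0 _ _).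
  rewrite (_ : Ordinal e_lt = ord_max); last exact: val_inj.
  by apply: etrans (congr1 sval h1) (pt0 _ _).
have := congr1 sval (psnat (loops n a h) u (idm a, ncst (D a) e)).
rewrite /= end0 /Ntilde_map cochain_map0 if_same comp_idl => <-.
congr (sval (_ _ (_, _))); apply: nerveP => i; rewrite !ffunE //.
Qed.

Lemma to_Omega_subproof n (A : presheaf C)
    (M : psmap (tensor D A (stdsimplex 1)) (K n.+1)) :
  (forall a x e, sval (M a (x, ncst (D a) e)) = 0) ->
  forall a x, path_ends D (K n.+1) a (expo_curry M a x) =
     pspair (pt n.+1) (pt n.+1) a tt.
Proof.
move=> M0 a x; congr (_, _); apply: cocycles_eq; rewrite pt0; exact: M0.
Qed.

Program Definition to_Omega n (A : presheaf C)
    (M : psmap (tensor D A (stdsimplex 1)) (K n.+1))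
    (M0 : forall a x e, sval (M a (x, ncst (D a) e)) = 0) :
    psmap A (Omega D (B n.+1)) :=
  @PsMap C A (Omega D (B n.+1))
    (fun a x => exist _ (expo_curry M a x, tt) (to_Omega_subproof M0 x)) _.
Next Obligation.
move=> n A M M0 a b f x; apply: eq_exist.
by rewrite (psnat (expo_curry M)).
Qed.

Lemma Omega_eq n a (x y : Omega D (B n.+1) a) :
  (forall b u phi, sval (loops n a x b (u, phi)) = sval (loops n a y b (u, phi))) -> x = y.
Proof.
case: x y => -[x []] xP [[y []] yP] /= xy; apply: eq_exist; congr (_, _).
by apply: psmap_eq => b [u phi]; apply: cocycles_eq; apply: xy.
Qed.

Lemma suspend_ends n a (w : K n a) e :
  sval (pscomp (cob n) (pscomp (cut n) (tensor_map D (inclE n) (psid (stdsimplex 1))))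
    a (w, ncst (D a) e)) = 0.
Proof.
rewrite /=; case: e => -[|[|//]] e_lt.
  rewrite (_ : Ordinal e_lt = ord0) ?cutoff_cst0 ?coboundary0 //; exact: val_inj.
rewrite (_ : Ordinal e_lt = ord_max) ?cutoff_cst1; last exact: val_inj.
by case: (svalP w).
Qed.

Definition suspend_Omega n : psmap (K n) (Omega D (B n.+1)) :=
  to_Omega (@suspend_ends n).

Lemma integral_cocycle n a (x : Omega D (B n.+1) a) :
  Ntilde p (integral (loops n a x)) /\ coboundary (integral (loops n a x)) = 0.
Proof.
split; first exact: integral_Ntilde.
by rewrite coboundary_integral !loops_ends subrr.
Qed.

Program Definition integrate_Omega n : psmap (Omega D (B n.+1)) (K n) :=
  @PsMap C (Omega D (B n.+1)) (K n) (fun a x => exist _ _ (integral_cocycle x)) _.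
Next Obligation.
move=> n a b f x; apply: cocycles_eq.
have := congr1 sval (psnat (pscomp (integrate n) (loops n)) f x); exact.
Qed.

(** Evaluation composed with the minimum: the path runs along [h] up to the parameter and then
    stops. *)
Definition truncate n : psmap (tensor D (cyl n) (stdsimplex 1)) (cyl n) :=
  expo_curry (pscomp (expo_uncurry (psid (cyl n))) (stdmeet D (cyl n))).

Lemma truncateE n a (h : cyl n a) (phi : stdsimplex 1 (D a)) b (u : hom b a)
    (e : stdsimplex 1 (D b)) :
  truncate n a (h, phi) b (u, e) = h b (u, nmeet (ncomp phi (fmap I u)) e).
Proof. by rewrite /= comp_idr. Qed.

(** * Deformation of loops to suspensions of their integrals *)

Section Homotopy.
Variable n : nat.

Let O1 := tensor D (Omega D (B n.+1)) (stdsimplex 1).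
Let O2 := tensor D O1 (stdsimplex 1).
Let loop : psmap O2 (cyl n.+1) := pscomp (loops n) (pscomp (psfst _ _) (psfst _ _)).
Let psi : psmap O2 (restrict D (stdsimplex 1)) :=
  pscomp (pssnd _ _) (psfst O1 (restrict D (stdsimplex 1))).
Let phi : psmap O2 (restrict D (stdsimplex 1)) := pssnd O1 (restrict D (stdsimplex 1)).

(* [partial] integrates the loop over [[0, phi]] only; its coboundary is the
   value of the loop at [phi], so that [defect] is a cochain, natural and
   vanishing for constant [phi], whose coboundary is the difference between
   the loop and its image under [suspend_Omega \o integrate_Omega]. *)
Let total : psmap O2 (E n) := pscomp (cut n) (pspair (pscomp (integrate n) loop) phi).
Let partial : psmap O2 (E n) :=
  pscomp (integrate n) (pscomp (truncate n.+1) (pspair loop phi)).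
Let defect : psmap O2 (E n) := pscomp (subE n) (pspair partial total).

Definition homotopy : psmap O2 (K n.+1) :=
  pscomp (cob n) (pscomp (addE n) (pspair total (pscomp (cut n) (pspair defect psi)))).

(** For [x] constant 0 the suspension of the integral remains; for [x] constant 1 the coboundary of
    the partial integral, which is the loop at [y]. For constant [y] the bracket vanishes and the
    first term is 0 or a cocycle, so the loops stay based. *)
Lemma homotopyE a (h : Omega D (B n.+1) a) (x y : nerve 'I_2 (sdim (I a))) :
  sval (homotopy a ((h, x), y)) = coboundary (
    cutoff y (integral (loops n a h)) +
    cutoff x (integral (truncate n.+1 a (loops n a h, y)) -
              cutoff y (integral (loops n a h)))).
Proof. by []. Qed.

Lemma truncate0 a (h : Omega D (B n.+1) a) :
  integral (truncate n.+1 a (loops n a h, ncst (sdim (I a)) ord0)) = 0.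
Proof.
apply: integral0 => b u e; rewrite truncateE -[RHS](loops_ends h u ord0).
by congr (sval (_ _ (_, _))); apply: nerveP => i; rewrite !ffunE.
Qed.

Lemma truncate1 a (h : Omega D (B n.+1) a) :
  truncate n.+1 a (loops n a h, ncst (sdim (I a)) ord_max) = loops n a h.
Proof.
apply: psmap_eq => b [u e]; rewrite truncateE.
by congr (loops n a h b (_, _)); apply: nerveP => i; rewrite !ffunE.
Qed.

Lemma homotopy_ends a (x : O1 a) e : sval (homotopy a (x, ncst (D a) e)) = 0.
Proof.
case: x => h x; rewrite homotopyE; case: e => -[|[|//]] e_lt.
  rewrite (_ : Ordinal e_lt = ord0); last exact: val_inj.
  by rewrite truncate0 !cutoff_cst0 subrr cutoff0 addr0 coboundary0.
rewrite (_ : Ordinal e_lt = ord_max); last exact: val_inj.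
rewrite truncate1 !cutoff_cst1 subrr cutoff0 addr0.
by case: (integral_cocycle h).
Qed.

Definition homotopy_Omega : psmap O1 (Omega D (B n.+1)) := to_Omega homotopy_ends.

Lemma loops_homotopy a (x : O1 a) b (u : hom b a) (y : nerve 'I_2 (sdim (I b))) :
  sval (loops n a (homotopy_Omega a x) b (u, y)) = sval (homotopy b (act u x, y)).
Proof. by []. Qed.

Lemma loops_act a (h : Omega D (B n.+1) a) b (u : hom b a) c (v : hom c b) y :
  loops n b (act u h) c (v, y) = loops n a h c (comp u v, y).
Proof. by []. Qed.

Lemma act_end a (h : Omega D (B n.+1) a) b (u : hom b a) (e : 'I_2) :
  act u ((h, ncst (D a) e) : O1 a) = (act u h, ncst (D b) e).
Proof. by congr (_, _); apply: nerveP => i; rewrite !ffunE. Qed.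

Lemma suspend_Omega_equivalence : weak_s_equivalence D (suspend_Omega n).
Proof.
apply: (deformation_equivalence (g := integrate_Omega n) (h := homotopy_Omega)).
- by move=> a w; apply: cocycles_eq; apply: integral_suspend.
- move=> a h; apply: Omega_eq => b u y.
  rewrite loops_homotopy act_end homotopyE cutoff_cst0 addr0 /=; congr (coboundary (cutoff _ _)).
  exact: (congr1 sval (psnat (pscomp (integrate n) (loops n)) u h)).
move=> a h; apply: Omega_eq => b u y.
rewrite loops_homotopy act_end homotopyE cutoff_cst1 addrC subrK.
rewrite coboundary_integral !truncateE !loops_act comp_idr.
(* The truncated path starts at the base point, since the minimum with the vertex 0 is 0; its other
   end is the loop at [y]. *)
rewrite [X in _ - X](_ : _ = 0) ?subr0; last first.
  rewrite -[RHS](loops_ends h u ord0); congr (sval (_ _ (_, _))).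
  by apply: nerveP => i; rewrite !ffunE if_same.
congr (sval (_ _ (_, _))); apply: nerveP => i; rewrite !ffunE fmap_id ffunE.
by case: (y i) => -[|[|//]] j_lt /=; [apply: val_inj|apply: val_inj].
Qed.

End Homotopy.

Lemma EM_infinite_loop_space : infinite_loop_space D B.
Proof.
split=> [n Z|n]; first exact: EM_kan.
by exists (suspend_Omega n); apply: suspend_Omega_equivalence.
Qed.

End LoopSpaces.

(** * The two categories of simplices *)

Definition functor_id (C : category) : functor C C :=
  @Functor C C id (fun _ _ => id) (fun _ => erefl) (fun _ _ _ _ _ => erefl).

Lemma functor_comp_id (C E : category) (F : functor C E) :
  functor_comp F (functor_id C) = F.
Proof.
case: F => ob map map_id map_comp; congr Functor; apply: Prop_irrelevance.
Qed.

(** The two pointed objects share their data and differ only in the proofs of the laws. *)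
Lemma pointed_restrict_id (C : category) (X : pointed C) :
  @Pointed C (restrict (functor_id C) X)
    (@PsMap C (final C) (restrict (functor_id C) X) (point X) (psnat (point X))) = X.
Proof.
case: X => -[ob act act_id act_comp] [f f_nat].
have irrelevant id1 comp1 id2 comp2 (g : forall a, unit -> ob a) nat1 nat2 :
    Pointed (@PsMap C (final C) (@Presheaf C ob act id1 comp1) g nat1) =
    Pointed (@PsMap C (final C) (@Presheaf C ob act id2 comp2) g nat2).
  move: nat1 nat2; rewrite (Prop_irrelevance id1 id2) (Prop_irrelevance comp1 comp2).
  by move=> nat1 nat2; rewrite (Prop_irrelevance nat1 nat2).
exact: irrelevant.
Qed.

Theorem theorem5p6 (R : comPzRingType) (d : Order.disp_t) (P : porderType d)
    (p : perversity P) :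
  infinite_loop_space (dimP P) (fun n : nat => EM_pointed R p n) /\
  infinite_loop_space (dimPreg P) (fun n : nat => EM_plus_pointed R p n).
Proof.
split; last first.
  apply: (@EM_infinite_loop_space R d P p (DeltaPreg P) (DeltaPreg_incl P)) => //.
  - by move=> a b f; exists f.
  - by move=> t t_reg; exists (exist _ t t_reg).
pose pt n : psmap (final (DeltaP P)) (restrict (functor_id _) (EM R p n)) :=
  @PsMap _ _ (restrict (functor_id _) (EM R p n)) (EM_point R p n) (psnat (EM_point R p n)).
(* Over Δ[P] itself the general result applies to the identity functor, so the statement is first
   written as a restriction along it. *)
rewrite -(functor_comp_id (dimP P)).
have -> : (fun n => EM_pointed R p n) = fun n => Pointed (pt n).
  by apply: funext => n; apply/esym/(pointed_restrict_id (EM_pointed R p n)).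
apply: (@EM_infinite_loop_space R d P p (DeltaP P) (functor_id _) _ _ _ pt) => //.
- by move=> a b f; exists f.
- by move=> t _; exists t.
Qed.
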